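(* Let $n\ge 3$ and let $\mathcal{U}=(u_1,u_2)\in C^2(\mathbb{R}^n\setminus\{0\})$ be a nonnegative singular solution of $$\Delta u_i+\frac{n(n-2)}{4}|\mathcal{U}|^{\frac{4}{n-2}}u_i=0\quad\text{in }\mathbb{R}^n\setminus\{0\},\qquad i=1,2.$$ Then there exist $\Lambda\in\mathbb{S}^1_+=\{x=(x_1,x_2)\in\mathbb{S}^1: x_1\ge 0,\ x_2\ge 0\}$ and a Fowler solution $u_0$ such that $\mathcal{U}=u_0\Lambda$.
   Context: $\Delta$ is the Euclidean Laplacian and $|\mathcal{U}|=(u_1^2+u_2^2)^{1/2}$. Nonnegative means $u_1\ge 0$ and $u_2\ge 0$ everywhere. The solution is called singular if $\lim_{|x|\to 0}|\mathcal{U}(x)|=+\infty$. A Fowler solution is a positive radial solution $u$ of $\Delta u+\frac{n(n-2)}{4}u^{\frac{n+2}{n-2}}=0$ in $\mathbb{R}^n\setminus\{0\}$ that blows up at $0$ (i.e. $u(x)\to+\infty$ as $x\to 0$). *)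

(* Defs.v *)
From HB Require Import structures.
From mathcomp Require Import all_boot all_order all_algebra.
From mathcomp Require Import all_classical all_reals all_analysis.

Set Implicit Arguments.
Unset Strict Implicit.
Unset Printing Implicit Defensive.

Import Order.TTheory GRing.Theory Num.Theory.
Import numFieldNormedType.Exports.

Local Open Scope classical_set_scope.
Local Open Scope ring_scope.

(* The library norm `|x| on 'rV[R]_n is the max norm; it induces the same
   topology (hence the same limits) as [enorm]. *)
Definition enorm (R : realType) (n : nat) (x : 'rV[R]_n) : R :=
  Num.sqrt (\sum_(i < n) x ord0 i ^+ 2).

Definition evec (R : realType) (n : nat) (i : 'I_n) : 'rV[R]_n :=
  delta_mx ord0 i.

Definition partial (R : realType) (n : nat) (i : 'I_n) (f : 'rV[R]_n -> R) :
  'rV[R]_n -> R := fun x => 'D_(evec R i) f x.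

Definition laplacian (R : realType) (n : nat) (f : 'rV[R]_n -> R)
  (x : 'rV[R]_n) : R := \sum_(i < n) partial i (partial i f) x.

Definition punctured (R : realType) (n : nat) : set 'rV[R]_n :=
  [set x | x != 0].

(* C^1 and C^2 on a set A, which is meant to be open. Functions are total, but
   partial derivatives at a point of A only see the values of f near it. *)
Definition C1_on (R : realType) (n : nat) (A : set 'rV[R]_n)
    (f : 'rV[R]_n -> R) : Prop :=
  forall x, A x ->
    {for x, continuous f} /\
    forall i : 'I_n,
      derivable f x (evec R i) /\ {for x, continuous (partial i f)}.

Definition C2_on (R : realType) (n : nat) (A : set 'rV[R]_n)
    (f : 'rV[R]_n -> R) : Prop :=
  C1_on A f /\ forall i : 'I_n, C1_on A (partial i f).

Definition blows_up_at0 (R : realType) (n : nat) (f : 'rV[R]_n -> R) : Prop :=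
  f x @[x --> (0 : 'rV[R]_n)^'] --> +oo.

Definition radial (R : realType) (n : nat) (f : 'rV[R]_n -> R) : Prop :=
  exists phi : R -> R, forall x, @punctured R n x -> f x = phi (enorm x).

Definition fowler_solution (R : realType) (n : nat) (u : 'rV[R]_n -> R) :
    Prop :=
  [/\ C2_on (@punctured R n) u,
      forall x, @punctured R n x -> 0 < u x,
      radial u,
      forall x, @punctured R n x ->
        laplacian u x
        + n%:R * (n%:R - 2) / 4 * u x `^ ((n%:R + 2) / (n%:R - 2)) = 0
    & blows_up_at0 u].

Definition component (R : realType) (n : nat) (U : 'rV[R]_n -> 'rV[R]_2)
  (i : 'I_2) : 'rV[R]_n -> R := fun x => U x ord0 i.

Definition nonneg_singular_solution (R : realType) (n : nat)
    (U : 'rV[R]_n -> 'rV[R]_2) : Prop :=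
  [/\ forall i : 'I_2, C2_on (@punctured R n) (component U i),
      forall (i : 'I_2) x, @punctured R n x -> 0 <= component U i x,
      forall (i : 'I_2) x, @punctured R n x ->
        laplacian (component U i) x
        + n%:R * (n%:R - 2) / 4 * enorm (U x) `^ (4 / (n%:R - 2))
          * component U i x = 0
    & blows_up_at0 (fun x => enorm (U x))].

Definition sphere1_plus (R : realType) : set 'rV[R]_2 :=
  [set L | enorm L = 1 /\ forall i : 'I_2, 0 <= L ord0 i].

(* Main.v *)
(* Moving spheres. For x <> 0 and 0 < s < |x|^2, the Kelvin transform of U about
   the sphere of centre x and squared radius s stays componentwise below U
   outside that sphere. For small s, and again when s is pushed slightly beyond
   a value where the comparison holds, this follows from the maximum principle
   with an explicit strict supersolution of the linearised cooperative system;
   strict inequality comes from the blow-up of |U| at the origin through the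
   Green function of the exterior of the sphere. Two points y, z with |y| = |z|
   are exchanged by inversions with centre far away on their common line, which
   are all admissible, so in the limit u_i(y) = u_i(z) and U is radial.
   For the radial system the Wronskian w = r^(n-1) (u_1 u_2' - u_2 u_1') and the
   Pohozaev integral are constant; the latter bounds r^(n-2) |U|^2, so w <> 0
   would give (u_2/u_1)' >= C/r up to exchanging u_1 and u_2, and the ratio would
   be negative near 0. Hence w = 0 and u_2/u_1 is constant. *)

Require Import Defs.
From mathcomp Require Import all_boot all_order all_algebra.
From mathcomp Require Import all_classical all_reals all_analysis.
From mathcomp Require Import ring lra.

Set Implicit Arguments.
Unset Strict Implicit.
Unset Printing Implicit Defensive.

Import Order.TTheory GRing.Theory Num.Theory.
Import numFieldNormedType.Exports.

Local Open Scope classical_set_scope.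
Local Open Scope ring_scope.

(** * Directional derivatives and the Euclidean norm *)

(** No growth bound for U at the origin or at infinity is known in advance. The comparison therefore
    estimates only the Kelvin transform, which is built from the values of U on a closed ball around
    x that misses the origin, and which tends to 0 at infinity. Since U >= 0, the negative part of
    the difference is at most the transform; dividing by a function that is at least 1 + |y|^(-1/2)
    makes it small near the origin and at infinity, so a negative minimum is attained. The condition
    s < |x|^2 is exactly what keeps the origin out of the ball. A component that vanishes
    identically cannot satisfy a strict comparison, hence the dichotomy [u_zero_or_pos], which also
    allows the ratio u_2/u_1 to be formed. Laplacians are taken in the pointwise sense [has_lap]:
    the maximum principle asks for nothing more, and no C^2 regularity of Kelvin transforms has to
    be established. Squared norms and squared radii are used throughout, so exponents are half the
    usual ones: |y|^(2-n) is the power -(n-2)/2 of [sqn y]. *)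

Section DirectionalDerivatives.
Context {R : realType} {V : normedModType R}.
Implicit Types (f g : V -> R) (x v : V).

Lemma is_deriveDf f g x v (a b : R) : is_derive x v f a -> is_derive x v g b ->
  is_derive x v (fun z => f z + g z) (a + b).
Proof. by move=> fa gb; exact: is_deriveD. Qed.

Lemma is_deriveBf f g x v (a b : R) : is_derive x v f a -> is_derive x v g b ->
  is_derive x v (fun z => f z - g z) (a - b).
Proof. by move=> fa gb; exact: is_deriveB. Qed.

Lemma is_deriveMf f g x v (a b : R) : is_derive x v f a -> is_derive x v g b ->
  is_derive x v (fun z => f z * g z) (f x * b + g x * a).
Proof. by move=> fa gb; exact: is_deriveM. Qed.

Lemma is_deriveZf (k : R) f x v (a : R) : is_derive x v f a ->
  is_derive x v (fun z => k * f z) (k * a).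
Proof. by move=> fa; exact: is_deriveZ. Qed.

Lemma is_derive_sumf n (h : 'I_n -> V -> R) x v (a : 'I_n -> R) :
  (forall i, is_derive x v (h i) (a i)) ->
  is_derive x v (fun z => \sum_i h i z) (\sum_i a i).
Proof.
move=> ha; have := @is_derive_sum _ _ _ n h x v a ha.
by congr (is_derive x v _ _); rewrite fct_sumE.
Qed.

(** Both sides have the same difference quotient, which reduces directional derivatives to functions
    of one real variable. *)
Lemma is_derive_slice f x v (a : R) :
  is_derive x v f a <-> is_derive (0 : R) 1 (fun h : R => f (h *: v + x)) a.
Proof.
have E : (fun h : R => h^-1 *: (f (h *: v + x) - f x)) =
  (fun h : R => h^-1 *: (f ((h *: (1 : R^o) + 0 : R) *: v + x) - f (0 *: v + x))).
  by apply/funext => h; rewrite addr0 scale0r add0r [_%:A]mulr1.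
by split=> -[d1 d2]; split; move: d1 d2; rewrite /derivable /derive /= E.
Qed.

Lemma is_derive_comp1 f x v (a : R) (g : R -> R) (b : R) :
  is_derive x v f a -> is_derive (f x) 1 g b ->
  is_derive x v (fun z => g (f z)) (b * a).
Proof.
move=> /is_derive_slice [d1 d2] [d3 d4]; apply/is_derive_slice.
have d3' : derivable g (f (0 *: v + x)) 1 by rewrite scale0r add0r.
split; last first.
  rewrite -derive1E (derive1_comp d1 d3') !derive1E d2.
  by rewrite scale0r add0r d4.
apply/derivable1_diffP.
by apply: (@differentiable_comp _ _ _ _ (fun h : R => f (h *: v + x)) g);
  apply/derivable1_diffP.
Qed.

End DirectionalDerivatives.

Section EuclideanNorm.
Context {R : realType} {n : nat}.
Implicit Types (x y z : 'rV[R]_n).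

Definition dot x y : R := \sum_i x ord0 i * y ord0 i.
Definition sqn x : R := \sum_i x ord0 i ^+ 2.

Lemma sqnE x : sqn x = dot x x.
Proof. by apply: eq_bigr => i _; rewrite expr2. Qed.

Lemma dotC x y : dot x y = dot y x.
Proof. by apply: eq_bigr => i _; rewrite mulrC. Qed.

Lemma dotDl x y z : dot (x + y) z = dot x z + dot y z.
Proof. by rewrite -big_split; apply: eq_bigr => i _; rewrite mxE mulrDl. Qed.

Lemma dotZl (a : R) x y : dot (a *: x) y = a * dot x y.
Proof. by rewrite /dot mulr_sumr; apply: eq_bigr => i _; rewrite mxE mulrA. Qed.

Lemma dotDr x y z : dot x (y + z) = dot x y + dot x z.
Proof. by rewrite dotC dotDl !(dotC x). Qed.

Lemma dotZr (a : R) x y : dot x (a *: y) = a * dot x y.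
Proof. by rewrite dotC dotZl dotC. Qed.

Lemma dotNl x y : dot (- x) y = - dot x y.
Proof. by rewrite -scaleN1r dotZl mulN1r. Qed.

Lemma dotNr x y : dot x (- y) = - dot x y.
Proof. by rewrite dotC dotNl dotC. Qed.

Definition dotE := (dotDl, dotDr, dotZl, dotZr, dotNl, dotNr).

Lemma sqn_ge0 x : 0 <= sqn x.
Proof. by apply: sumr_ge0 => i _; rewrite sqr_ge0. Qed.

Lemma sqn_eq0 x : (sqn x == 0) = (x == 0).
Proof.
rewrite /sqn psumr_eq0; last by move=> i _; exact: sqr_ge0.
apply/allP/eqP => [h|-> i _]; last by rewrite mxE expr0n /= eqxx.
apply/rowP => i; rewrite mxE; apply/eqP; rewrite -sqrf_eq0.
exact: (implyP (h i (mem_index_enum i))).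
Qed.

Lemma sqn0 : sqn 0 = 0.
Proof. by apply/eqP; rewrite sqn_eq0. Qed.

Lemma sqn_gt0 x : (0 < sqn x) = (x != 0).
Proof. by rewrite lt_def sqn_ge0 andbT sqn_eq0. Qed.

Lemma sqnB x y : sqn (x - y) = sqn x - 2 * dot x y + sqn y.
Proof. by rewrite !sqnE !dotE (dotC y x); ring. Qed.

Lemma sqnBC x y : sqn (x - y) = sqn (y - x).
Proof. by rewrite !sqnB (dotC y); ring. Qed.

Lemma sqnD_le x y : sqn (x + y) <= 2 * sqn x + 2 * sqn y.
Proof.
have := sqn_ge0 (x - y); rewrite !sqnE !dotE (dotC y x); lra.
Qed.

Lemma sqr_coord_le x i : x ord0 i ^+ 2 <= sqn x.
Proof.
rewrite /sqn (bigD1 i) //= lerDl.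
by apply: sumr_ge0 => j _; rewrite sqr_ge0.
Qed.

Lemma normr_sqr_le x : `|x| ^+ 2 <= sqn x.
Proof.
have h : `|x| <= Num.sqrt (sqn x).
  rewrite /Num.Def.normr/= mx_normrE.
  apply: bigmax_le; rewrite ?sqrtr_ge0 // => -[i j] _ /=.
  by rewrite -sqrtr_sqr ler_sqrt ?sqn_ge0 // (ord1 i) sqr_coord_le.
rewrite -(sqr_sqrtr (sqn_ge0 x)) ler_pXn2r // nnegrE ?sqrtr_ge0 //.
Qed.

Lemma sqn_bounded (A : set 'rV[R]_n) (M : R) :
  (forall y, A y -> sqn y <= M) -> bounded_set A.
Proof.
move=> h; exists (Num.sqrt M); split; first exact: num_real.
move=> N hN y /h hy /=; apply: le_trans (ltW hN).
rewrite -(@ger0_norm _ `|y|) // -sqrtr_sqr ler_wsqrtr //.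
exact: le_trans (normr_sqr_le _) hy.
Qed.

Lemma is_derive_coord x y (i j : 'I_n) :
  is_derive y (evec R i) (fun z => (z - x) ord0 j) ((i == j)%:R : R).
Proof.
apply/is_derive_slice.
have -> : (fun h : R => (h *: evec R i + y - x) ord0 j) =
   (fun h : R => (i == j)%:R * h + (y - x) ord0 j).
  by apply/funext => h; rewrite !mxE eqxx /= (eq_sym j) mulrC addrA.
rewrite -[X in is_derive _ _ _ X]addr0; apply: is_deriveDf.
rewrite -[X in is_derive _ _ _ X]mulr1; exact: is_deriveZf.
Qed.

Lemma is_derive_sqn x y (i : 'I_n) :
  is_derive y (evec R i) (fun z => sqn (z - x)) (2 * (y - x) ord0 i).
Proof.
apply: is_derive_eq.
  apply: is_derive_sumf => j; apply: (is_deriveMf (is_derive_coord x y i j)).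
  exact: is_derive_coord.
rewrite (bigD1 i) //= big1; last first.
  by move=> j ji; rewrite eq_sym (negbTE ji) !mulr0 addr0.
by rewrite eqxx /=; set t := (y - x) ord0 i; ring.
Qed.

Lemma continuous_sqn : continuous sqn.
Proof.
apply: continuous_big => [|i _ y]; first exact: add_continuous.
by apply: (@cvgM R _ (nbhs y)); exact: coord_continuous.
Qed.

Lemma continuous_sqnB x : continuous (fun y => sqn (y - x)).
Proof.
move=> y; apply: (@continuous_comp _ _ _ (fun z => z - x) sqn).
  by apply: (@continuousB R _ _ id (cst x)); [move=> ?|exact: cst_continuous].
exact: continuous_sqn.
Qed.

End EuclideanNorm.

(** * Mean values and the chain rule *)

Section Slices.
Context {R : realType} {V : normedModType R}.
Implicit Types (f : V -> R) (p v : V).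

Lemma is_derive_slice_at f p v (s d : R) : is_derive (s *: v + p) v f d ->
  is_derive s 1 (fun t : R => f (t *: v + p)) d.
Proof.
move=> /is_derive_slice h; apply/is_derive_slice; move: h.
congr (is_derive _ _ _ _); apply/funext => t /=.
by rewrite [_%:A]mulr1 scalerDl addrA.
Qed.

Lemma mvt_slice f p v (c : R) (df : R -> R) :
  (forall s : R, `|s| <= `|c| -> is_derive (s *: v + p) v f (df s)) ->
  exists2 s, `|s| <= `|c| & f (c *: v + p) - f p = df s * c.
Proof.
move=> h; pose G (t : R) := f (t *: v + p).
have hG (s : R) : `|s| <= `|c| -> is_derive s 1 G (df s).
  by move=> /h; exact: is_derive_slice_at.
have cG (a b : R) : `|a| <= `|c| -> `|b| <= `|c| ->
    {within `[a, b], continuous G}.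
  move=> ac bc; apply: derivable_within_continuous => s.
  rewrite in_itv /= => /andP[sa sb]; case: (hG s) => //.
  by move: ac bc; rewrite !ler_norml; lra.
have G0 : G 0 = f p by rewrite /G scale0r add0r.
have [c0|c0] := leP 0 c.
- have sc s : 0 <= s <= c -> `|s| <= `|c|.
    by move=> /andP[s0 sc]; rewrite !ger0_norm.
  have [s| |s sI E] := @MVT_segment R G df 0 c c0.
  + by rewrite in_itv /= => /andP[? ?]; apply: hG; apply: sc; rewrite !ltW.
  + by apply: cG; rewrite ?normr0 ?lexx.
  by exists s; [apply: sc; move: sI; rewrite in_itv|rewrite -G0 -[f _]/(G c) E subr0].
- have sc s : c <= s <= 0 -> `|s| <= `|c|.
    by move=> /andP[sc s0]; rewrite !ler0_norm ?lerN2 // ltW.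
  have [s| |s sI E] := @MVT_segment R G df c 0 (ltW c0).
  + by rewrite in_itv /= => /andP[? ?]; apply: hG; apply: sc; rewrite !ltW.
  + by apply: cG; rewrite ?normr0 ?lexx.
  exists s; first by apply: sc; move: sI; rewrite in_itv.
  by rewrite -G0 -[f _]/(G c) -opprB E sub0r mulrN opprK.
Qed.

Lemma cvg_norm_le (g : V -> V) (x : V) (r : R) : 0 < r ->
  (forall z, `|z - x| <= r -> `|g z - x| <= `|z - x|) -> g z @[z --> x] --> x.
Proof.
move=> r0 h; apply/cvgrPdist_le => e e0.
near=> z; have zr : `|z - x| <= Num.min r e.
  by near: z; apply: (@cvgr_distC_le _ _ _ _ _ id) => //; rewrite lt_min r0.
move: zr; rewrite le_min => /andP[zr ze].
by rewrite distrC; apply: le_trans ze; exact: h.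
Unshelve. all: by end_near. Qed.

End Slices.

Section ChainRule.
Context {R : realType} {n : nat}.
Implicit Types (f : 'rV[R]_n -> R) (x z : 'rV[R]_n).

Lemma coord_norm_le x (i : 'I_n) : `|x ord0 i| <= `|x|.
Proof.
rewrite [leRHS]/Num.Def.normr /= mx_normrE.
exact: (le_bigmax _ (fun ij : 'I_1 * 'I_n => `|x ij.1 ij.2|) (ord0, i)).
Qed.

(** Walk from x to z one coordinate at a time and apply the one-variable mean value theorem to each
    leg. In the max norm every leg stays within |z - x| of x. *)
Lemma mean_value_coord f x (r : R) z :
  (forall y i, `|y - x| <= r -> derivable f y (evec R i)) -> `|z - x| <= r ->
  exists xi : 'I_n -> 'rV[R]_n, (forall i, `|xi i - x| <= `|z - x|) /\
    f z - f x = \sum_i partial i f (xi i) * (z ord0 i - x ord0 i).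
Proof.
move=> df zr.
pose p (k : nat) : 'rV[R]_n := \row_i (if (i < k)%N then z ord0 i else x ord0 i).
have step (k : 'I_n) : exists y, `|y - x| <= `|z - x| /\
    f (p k.+1) - f (p k) = partial k f y * (z ord0 k - x ord0 k).
  pose c := z ord0 k - x ord0 k.
  have cle : `|c| <= `|z - x| by have := coord_norm_le (z - x) k; rewrite !mxE.
  have inb s : `|s| <= `|c| -> `|s *: evec R k + p k - x| <= `|z - x|.
    move=> sc; rewrite {1}/Num.Def.normr /= mx_normrE; apply: bigmax_le => // -[i j] _ /=.
    rewrite !mxE (ord1 i) eqxx /=; have [->|jk] := eqVneq j k.
      by rewrite ltnn mulr1 addrK; apply: le_trans cle.
    rewrite mulr0 add0r; case: ifP => _; last by rewrite subrr normr0.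
    by have := coord_norm_le (z - x) j; rewrite !mxE.
  have [s|s sc E] := @mvt_slice R _ f (p k) (evec R k) c
    (fun s => partial k f (s *: evec R k + p k)).
    move=> sc; apply: derivableP; apply: df; apply: le_trans zr.
    exact: inb.
  exists (s *: evec R k + p k); split; first exact: inb.
  rewrite -E; congr (f _ - _); apply/rowP => i; rewrite !mxE eqxx /=.
  have [->|ik] := eqVneq i k; first by rewrite ltnn ltnSn mulr1 /c subrK.
  by rewrite mulr0 add0r ltnS leq_eqVlt (inj_eq val_inj) (negbTE ik).
exists (fun k => sval (cid (step k))); split.
  by move=> k; case: (cid (step k)) => y [].
have -> : f z - f x = f (p n) - f (p 0%N).
  by congr (f _ - f _); apply/rowP => i; rewrite !mxE ?ltn_ord.
rewrite -(@telescope_sumr _ 0 n (fun k => f (p k))) // big_mkord.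
by apply: eq_bigr => k _; case: (cid (step k)) => y [].
Qed.

(** Continuity of the partial derivatives at [T y] takes the place of Frechet differentiability: the
    increment of f is a sum of partial derivatives at intermediate points, and these points converge
    to [T y]. *)
Lemma chain_rule (V : normedModType R) f (T : V -> 'rV[R]_n) (y v : V)
    (d : 'I_n -> R) :
  (\forall z \near T y, forall i, derivable f z (evec R i)) ->
  (forall i, {for T y, continuous (partial i f)}) ->
  (forall j, is_derive y v (fun w => T w ord0 j) (d j)) ->
  is_derive y v (fun w => f (T w)) (\sum_j partial j f (T y) * d j).
Proof.
move=> df cf dT; set x := T y.
have [r /= r0 hr] : exists2 r, 0 < r &
    forall z i, `|z - x| <= r -> derivable f z (evec R i).
  have /nbhs_ballP [r /= r0 hr] := df; exists (r / 2); first by rewrite divr_gt0.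
  move=> z i zr; apply: hr; rewrite -ball_normE /= distrC.
  by rewrite (le_lt_trans zr) // ltr_pdivrMr // ltr_pMr // ltr1n.
have ex z : exists xi : 'I_n -> 'rV[R]_n, `|z - x| <= r ->
    (forall i, `|xi i - x| <= `|z - x|) /\
    f z - f x = \sum_i partial i f (xi i) * (z ord0 i - x ord0 i).
  have [zr|zr] := leP `|z - x| r; last by exists (fun=> x).
  by have [xi hxi] := mean_value_coord hr zr; exists xi.
(* The choice is made for every z but carries information only within distance r of x, where it
   forces [xi z] to tend to x. *)
pose xi z := sval (cid (ex z)).
have hxi z : `|z - x| <= r -> (forall i, `|xi z i - x| <= `|z - x|) /\
    f z - f x = \sum_i partial i f (xi z i) * (z ord0 i - x ord0 i).
  by rewrite /xi; case: (cid (ex z)).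
have cxi i : xi z i @[z --> x] --> x.
  by apply: (cvg_norm_le r0) => z /hxi [].
have cT : T (h *: v + y) @[h --> (0 : R)^'] --> x.
  have /derivable_mxP dTm : forall (i : 'I_1) j, derivable (fun w => T w i j) y v.
    by move=> i j; rewrite (ord1 i); case: (dT j).
  have /derivable1P /derivable1_diffP /differentiable_continuous := dTm.
  move=> c; have {}c : T (h *: v + y) @[h --> (0 : R)] --> T ((0 : R) *: v + y) := c.
  rewrite scale0r add0r in c; apply: cvg_trans c.
  by apply: cvg_app; exact: cvg_within.
have nr := @cvgr_distC_le R 'rV[R]_n R (0^') _ (fun h : R => T (h *: v + y)) x cT r r0.
suff lim : h^-1 *: (f (T (h *: v + y)) - f (T y)) @[h --> (0 : R)^'] -->
    \sum_j partial j f x * d j.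
  by split; [apply/cvg_ex; eexists; exact: lim|exact: cvg_lim lim].
have lim2 : \sum_j (partial j f (xi (T (h *: v + y)) j) *
     (h^-1 *: (T (h *: v + y) ord0 j - T y ord0 j))) @[h --> (0 : R)^'] -->
    \sum_j partial j f x * d j.
  apply: cvg_big => [|j _]; first exact: add_continuous.
  apply: cvgM.
    have c1 := cvg_comp _ _ cT (cxi j).
    have c2 := cvg_comp _ _ c1 (cf j).
    exact: c2.
  by have [dj <-] := dT j; exact: dj.
apply: cvg_trans lim2; apply: near_eq_cvg; near=> h.
have hr' : `|T (h *: v + y) - x| <= r.
  by near: h; exact: nr.
have [_ ->] := hxi _ hr'; rewrite scaler_sumr; apply: eq_bigr => j _.
by rewrite scalerAr.
Unshelve. all: by end_near. Qed.

End ChainRule.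

(** * Pointwise Laplacian *)

Section PointwiseLaplacian.
Context {R : realType} {n : nat}.
Implicit Types (f g : 'rV[R]_n -> R) (x y z : 'rV[R]_n) (L : R).

(* A pointwise Laplacian that only asks for the second derivatives at [y]
   itself: no continuity, and no mixed derivatives. *)
Definition has_lap f y L : Prop :=
  exists (g : 'I_n -> 'rV[R]_n -> R) (h : 'I_n -> R),
  [/\ \forall z \near y, forall i, is_derive z (evec R i) f (g i z),
      forall i, is_derive y (evec R i) (g i) (h i) & L = \sum_i h i].

Lemma has_lapD f1 f2 y L1 L2 : has_lap f1 y L1 -> has_lap f2 y L2 ->
  has_lap (fun z => f1 z + f2 z) y (L1 + L2).
Proof.
move=> [g1 [h1 [n1 d1 ->]]] [g2 [h2 [n2 d2 ->]]].
exists (fun i z => g1 i z + g2 i z), (fun i => h1 i + h2 i); split.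
- by apply: filterS2 n1 n2 => z H1 H2 i; exact: is_deriveDf.
- by move=> i; exact: is_deriveDf.
- by rewrite big_split.
Qed.

Lemma has_lapZ (k : R) f y L : has_lap f y L ->
  has_lap (fun z => k * f z) y (k * L).
Proof.
move=> [g1 [h1 [n1 d1 ->]]].
exists (fun i z => k * g1 i z), (fun i => k * h1 i); split.
- by apply: filterS n1 => z H1 i; exact: is_deriveZf.
- by move=> i; exact: is_deriveZf.
- by rewrite mulr_sumr.
Qed.

Lemma has_lapB f1 f2 y L1 L2 : has_lap f1 y L1 -> has_lap f2 y L2 ->
  has_lap (fun z => f1 z - f2 z) y (L1 - L2).
Proof.
move=> h1 /(has_lapZ (-1)) /(has_lapD h1); rewrite mulN1r.
by congr (has_lap _ _ _); apply/funext => z; rewrite mulN1r.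
Qed.

Lemma has_lap_cst (k : R) y : has_lap (fun=> k) y 0.
Proof.
exists (fun _ _ => 0), (fun=> 0); split.
- by apply: filterE => z i; exact: is_derive_cst.
- by move=> i; exact: is_derive_cst.
- by rewrite big1.
Qed.

Lemma has_lap_eq f y L L' : has_lap f y L -> L = L' -> has_lap f y L'.
Proof. by move=> h <-. Qed.

Lemma near_nbhs (T : topologicalType) (y : T) (P Q : T -> Prop) :
  (\forall z \near y, P z) -> (forall z : T, (\forall w \near z, P w) -> Q z) ->
  \forall z \near y, Q z.
Proof. by move=> h H; apply: filterS (near_join h). Qed.

Lemma near_eq_has_lap f1 f2 y L : (\forall z \near y, f1 z = f2 z) ->
  has_lap f1 y L -> has_lap f2 y L.
Proof.
move=> e12 [g [h [ng dg E]]]; exists g, h; split => //.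
apply: near_nbhs (filterI ng e12) _ => z nz i.
have [zg _] := nbhs_singleton nz.
by apply: near_eq_is_derive (zg i); apply: filterS nz => w [].
Qed.

Lemma C2_has_lap (A : set 'rV[R]_n) f y : open A -> A y -> C2_on A f ->
  has_lap f y (laplacian f y).
Proof.
move=> oA Ay [c1 c2].
exists (fun i => partial i f), (fun i => partial i (partial i f) y); split => //.
- apply: filterS (open_nbhs_nbhs (conj oA Ay)) => z Az i.
  by apply: derivableP; have [_ /(_ i) []] := c1 _ Az.
- by move=> i; apply: derivableP; have [_ /(_ i) []] := c2 i _ Ay.
Qed.

Lemma has_lap_laplacian f y L : has_lap f y L -> laplacian f y = L.
Proof.
move=> [g [h [ng dg ->]]]; apply: eq_bigr => i _.
rewrite /partial (@near_eq_derive _ _ _ _ (g i)).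
  by case: (dg i).
by apply: filterS ng => z /(_ i) [].
Qed.

(** [k1] vanishes at the minimum 0. If d were negative, [k1] would be negative just to the right of
    0, and by the mean value theorem k would drop below its minimum there. *)
Lemma second_derivative_min (k k1 : R -> R) (d : R) :
  (\forall t \near (0 : R), is_derive (t : R) 1 k (k1 t)) ->
  is_derive (0 : R) 1 k1 d -> (\forall t \near (0 : R), k 0 <= k t) -> 0 <= d.
Proof.
move=> dk [dk1 <-] kmin; rewrite leNgt; apply/negP => dneg.
have [r /= r0 hr] : exists2 r, 0 < r & forall t : R, `|t| <= r ->
    is_derive t 1 k (k1 t) /\ k 0 <= k t.
  have [r /= r0 hr] := filterI dk kmin; exists (r / 2); first by rewrite divr_gt0.
  move=> t tr; apply: hr; rewrite /ball_ /= sub0r normrN.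
  by rewrite (le_lt_trans tr) // ltr_pdivrMr // ltr_pMr // ltr1n.
have k10 : k1 0 = 0.
  have [|_ <-] := (hr 0 _).1; first by rewrite normr0 ltW.
  suff : is_derive (0 : R) 1 k 0 by case.
  have inr' t : t \in `]-r, r[ -> `|t| <= r.
    by rewrite in_itv /= ler_norml => /andP[/ltW -> /ltW ->].
  apply: (@derive1_at_min R k (- r) r 0).
  - lra.
  - by move=> t /inr' /hr [[]].
  - by rewrite in_itv /=; lra.
  - by move=> t /inr' /hr [].
have : nbhs (0 : R) (fun h : R => h != 0 ->
    h^-1 *: (k1 (h *: (1 : R^o) + 0 : R) - k1 0) < 0).
  exact: (@cvgr_lt _ _ (0^') _ _ _ dk1 0 dneg).
move=> /nbhs_ballP [e /= e0 he].
pose t := Num.min r (e / 2); have t0 : 0 < t by rewrite lt_min r0 divr_gt0.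
have [s sI E] : exists2 s, s \in `]0, t[ & k t - k 0 = k1 s * (t - 0).
  have tr s : 0 <= s <= t -> `|s| <= r.
    by move=> /andP[s0]; rewrite le_min ger0_norm // => /andP[].
  apply: MVT => // [s|].
    by rewrite in_itv /= => /andP[s0 st]; apply: (hr s _).1; apply: tr; rewrite !ltW.
  apply: derivable_within_continuous => s; rewrite in_itv /= => /tr /hr [[]] //.
move: sI; rewrite in_itv /= => /andP[s0 st].
have kt : k 0 <= k t by apply: (hr t _).2; rewrite gtr0_norm // /t ge_min lexx.
have k1s : k1 s < 0.
  have : ball (0 : R) e s.
    rewrite /ball /= sub0r normrN gtr0_norm // (lt_trans st) // gt_min.
    by rewrite ltr_pdivrMr // ltr_pMr // ltr1n orbT.
  move=> /he /(_ (lt0r_neq0 s0)) /=.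
  by rewrite k10 addr0 subr0 [_%:A]mulr1 pmulr_rlt0 // invr_gt0.
have : k1 s * (t - 0) < 0 by rewrite subr0 nmulr_rlt0.
by rewrite -E; lra.
Qed.

Lemma has_lap_min f y L : has_lap f y L -> (\forall z \near y, f y <= f z) ->
  0 <= L.
Proof.
move=> [g [h [ng dg ->]]] fmin; apply: sumr_ge0 => i _.
have sl (P : 'rV[R]_n -> Prop) : (\forall z \near y, P z) ->
    \forall t \near (0 : R), P (t *: evec R i + y).
  move=> Py; have c : (fun t : R => t *: evec R i + y) @ (0 : R) --> y.
    rewrite -[X in _ --> X]add0r -(scale0r (evec R i)).
    by apply: (@cvgD _ 'rV[R]_n); [exact: scalel_continuous|exact: cvg_cst].
  exact: c.
apply: (@second_derivative_min (fun t => f (t *: evec R i + y))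
  (fun t => g i (t *: evec R i + y))).
- apply: filterS (sl _ ng) => t /(_ i).
  exact: is_derive_slice_at.
- exact: (proj1 (is_derive_slice _ _ _ _) (dg i)).
- by rewrite scale0r add0r; exact: (sl (fun z => f y <= f z) fmin).
Qed.

End PointwiseLaplacian.

(** * Radial powers and the Kelvin transform *)

Section RadialAndKelvin.
Context {R : realType} {n : nat}.
Implicit Types (f : 'rV[R]_n -> R) (x y z : 'rV[R]_n).

Lemma near_sqn_gt (c : R) x y : c < sqn (y - x) ->
  \forall z \near y, c < sqn (z - x).
Proof. by move=> h; exact: (cvgr_gt _ (@continuous_sqnB _ _ x y)). Qed.

Lemma is_derive_sqn_powR x y (s : R) (i : 'I_n) : 0 < sqn (y - x) ->
  is_derive y (evec R i) (fun z => sqn (z - x) `^ s)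
    (s * sqn (y - x) `^ (s - 1) * (2 * (y - x) ord0 i)).
Proof.
move=> q0; exact: (is_derive_comp1 (is_derive_sqn x y i) (is_derive1_powR s q0)).
Qed.

Lemma powRS (q s : R) : 0 < q -> q `^ (s + 1) = q * q `^ s.
Proof.
move=> q0; rewrite powRD; last by rewrite (gt_eqF q0) implybT.
by rewrite powRr1 ?ltW // mulrC.
Qed.

(** The factor vanishes at s = -(n-2)/2, the fundamental solution, is negative between that value
    and 0, and positive below it. Supersolutions are taken from both sides, with a negative
    coefficient in the second case. *)
Lemma has_lap_sqn_powR x y (s : R) : 0 < sqn (y - x) ->
  has_lap (fun z => sqn (z - x) `^ s) y
    (2 * s * (2 * s - 2 + n%:R) * sqn (y - x) `^ (s - 1)).
Proof.
move=> q0; set q := sqn (y - x).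
exists (fun i z => s * sqn (z - x) `^ (s - 1) * (2 * (z - x) ord0 i)),
  (fun i => 2 * s * q `^ (s - 1) +
            4 * s * (s - 1) * q `^ (s - 2) * (y - x) ord0 i ^+ 2); split.
- by apply: filterS (near_sqn_gt q0) => z zq i; exact: is_derive_sqn_powR.
- move=> i; apply: is_derive_eq.
    apply: is_deriveMf.
      by apply: is_deriveZf; exact: is_derive_sqn_powR.
    by apply: is_deriveZf; exact: (is_derive_coord x y i i).
  rewrite eqxx -/q (_ : s - 1 - 1 = s - 2); last by ring.
  by rewrite /=; set t := (y - x) ord0 i; ring.
rewrite big_split /= sumr_const card_ord -mulr_sumr -/(sqn _) -/q.
have -> : s - 1 = s - 2 + 1 by ring.
rewrite powRS // -(mulr_natl (2 * s * _) n); ring.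
Qed.

End RadialAndKelvin.

Lemma sum_delta (R : realType) (n : nat) (b : 'I_n -> R) (i : 'I_n) :
  \sum_j b j * (i == j)%:R = b i.
Proof.
rewrite (bigD1 i) //= big1 ?addr0; first by rewrite eqxx mulr1.
by move=> j ji; rewrite eq_sym (negbTE ji) mulr0.
Qed.

(** This replaces the symmetry of second derivatives: mixed partial derivatives enter the Laplacian
    of a Kelvin transform only through a quadratic form. *)
Lemma quadratic_form_tr (R : realType) (n : nat) (Z : 'I_n -> R)
    (D : 'I_n -> 'I_n -> R) :
  \sum_i Z i * (\sum_j Z j * D j i) = \sum_i Z i * (\sum_j Z j * D i j).
Proof.
transitivity (\sum_i \sum_j Z i * (Z j * D j i)).
  by apply: eq_bigr => i _; rewrite mulr_sumr.
rewrite exchange_big; apply: eq_bigr => i _; rewrite mulr_sumr.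
by apply: eq_bigr => j _; rewrite mulrCA.
Qed.

(** The left side has the shape of the pure second derivatives in [has_lap_kelvin]. *)
Lemma sum_lincomb (R : realType) (n : nat) (c1 c2 c3 c4 c5 c6 : R)
    (f1 f2 f3 f4 f5 : 'I_n -> R) :
  \sum_i (c1 * f1 i - c2 * f2 i - c3 * f3 i - c4 * f4 i + c5 * f5 i - c6) =
  c1 * (\sum_i f1 i) - c2 * (\sum_i f2 i) - c3 * (\sum_i f3 i)
  - c4 * (\sum_i f4 i) + c5 * (\sum_i f5 i) - n%:R * c6.
Proof.
by rewrite sumrB big_split /= !sumrB -!mulr_sumr sumr_const card_ord mulr_natl.
Qed.

Section Kelvin.
Context {R : realType} {n : nat} (x : 'rV[R]_n) (s : R).
Implicit Types (f u : 'rV[R]_n -> R) (y z : 'rV[R]_n).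

(* [s] is the square of the radius of the sphere of inversion. *)
Definition kfac z : R := s / sqn (z - x).
Definition inversion z : 'rV[R]_n := x + kfac z *: (z - x).
(** With s the square of the radius l, the weight is the usual (l / |z - x|)^(n-2). *)
Definition kelvin f z : R := kfac z `^ ((n%:R - 2) / 2) * f (inversion z).

(** The inversion has derivative [kfac] times the reflection I - 2 Z Z^T / |Z|^2 with Z = z - x; the
    reflected part of a gradient is Z times this radial sum. *)
Let Zsum f z := \sum_k (z - x) ord0 k * partial k f (inversion z).

Lemma is_derive_kfac y (i : 'I_n) : 0 < sqn (y - x) ->
  is_derive y (evec R i) kfac
    (- (2 * s / sqn (y - x) ^+ 2) * (y - x) ord0 i).
Proof.
move=> q0; have q1 : sqn (y - x) != 0 by rewrite gt_eqF.
have h := @is_derive_comp1 R _ _ _ _ _ (fun t => s * t^-1) (s * - (sqn (y - x) ^- 2))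
  (is_derive_sqn x y i).
apply: is_derive_eq; first apply: h.
- apply: is_deriveZf; apply: is_derive_eq.
    by apply: is_deriveV => //; exact: is_derive_id.
  by rewrite scaleNr [_ *: _]mulr1.
- by field.
Qed.

Lemma is_derive_inversion y (i j : 'I_n) : 0 < sqn (y - x) ->
  is_derive y (evec R i) (fun z => inversion z ord0 j)
   (kfac y * (i == j)%:R -
    2 * s / sqn (y - x) ^+ 2 * (y - x) ord0 i * (y - x) ord0 j).
Proof.
move=> q0.
have -> : (fun z => inversion z ord0 j) =
   (fun z => x ord0 j + kfac z * (z - x) ord0 j).
  by apply/funext => z; rewrite /inversion !mxE.
apply: is_derive_eq.
  apply: (is_deriveDf (is_derive_cst (x ord0 j) y (evec R i))).
  by apply: is_deriveMf; [exact: is_derive_kfac|exact: (is_derive_coord x y i j)].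
rewrite /=; set a := (y - x) ord0 i; set b := (y - x) ord0 j.
by ring.
Qed.

Lemma is_derive_comp_inversion (A : set 'rV[R]_n) f y (i : 'I_n) :
  open A -> C1_on A f -> A (inversion y) -> 0 < sqn (y - x) ->
  is_derive y (evec R i) (fun z => f (inversion z))
   (kfac y * partial i f (inversion y) -
    2 * s / sqn (y - x) ^+ 2 * (y - x) ord0 i * Zsum f y).
Proof.
move=> oA cf Ay q0; apply: is_derive_eq.
  apply: (@chain_rule _ _ _ f inversion).
  - apply: filterS (open_nbhs_nbhs (conj oA Ay)) => z Az j.
    by have [_ /(_ j) []] := cf _ Az.
  - by move=> j; have [_ /(_ j) []] := cf _ Ay.
  - by move=> j; exact: is_derive_inversion.
rewrite /Zsum mulr_sumr; under eq_bigr do rewrite mulrBr.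
rewrite sumrB; congr (_ - _).
  rewrite (bigD1 i) //= big1 ?addr0; first by rewrite eqxx /= mulr1 mulrC.
  by move=> j ji; rewrite eq_sym (negbTE ji) !mulr0.
by apply: eq_bigr => j _; set a := (y - x) ord0 i; set b := (y - x) ord0 j; ring.
Qed.

Lemma continuous_inversion y : 0 < sqn (y - x) -> {for y, continuous inversion}.
Proof.
move=> q0.
have ck : {for y, continuous kfac}.
  apply: (@continuousM R _ (cst s) (fun z => (sqn (z - x))^-1)).
    exact: cst_continuous.
  by apply: (@continuousV R _ (fun z => sqn (z - x))); [exact: lt0r_neq0|exact: continuous_sqnB].
apply: (@continuousD R _ _ (cst x)); first exact: cst_continuous.
apply: (@continuousZ R _ _ kfac (fun z => z - x)) => //.
by apply: (@continuousB R _ _ id (cst x)); [move=> ?|exact: cst_continuous].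
Qed.

(** Conformal covariance of the Laplacian: with the weight exponent (n-2)/2 the terms in u and in
    its gradient cancel. *)
Lemma has_lap_kelvin (A : set 'rV[R]_n) u y : open A -> C2_on A u ->
  A (inversion y) -> 0 < sqn (y - x) -> 0 < s ->
  has_lap (kelvin u) y
    (kfac y `^ ((n%:R + 2) / 2) * laplacian u (inversion y)).
Proof.
move=> oA [c1 c2] Ay q0 s0.
pose nu : R := (n%:R - 2) / 2.
pose q z := sqn (z - x).
pose v z := u (inversion z).
pose M z := s * Zsum u z + nu * (q z * v z).
(* The gradient of q^(-nu) v; [M] collects the coefficients of the radial vector z - x. *)
pose g i z := s * (q z `^ (- nu - 1) * partial i u (inversion z)) -
   2 * ((z - x) ord0 i * (q z `^ (- nu - 2) * M z)).
have nq : \forall z \near y, 0 < q z by exact: near_sqn_gt.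
have nA : \forall z \near y, A (inversion z).
  exact: (continuous_inversion q0 (open_nbhs_nbhs (conj oA Ay))).
(* The constant s^nu is split off, so that only powers of q are differentiated. *)
suff H : has_lap (fun z => q z `^ (- nu) * v z) y
   (s ^+ 2 * q y `^ (- nu - 2) * laplacian u (inversion y)).
  have := has_lapZ (s `^ nu) H.
  have -> : s `^ nu * (s ^+ 2 * q y `^ (- nu - 2) * laplacian u (inversion y)) =
      kfac y `^ ((n%:R + 2) / 2) * laplacian u (inversion y).
    rewrite mulrA; congr (_ * _).
    rewrite /kfac -/(q y) powRM ?invr_ge0 ?ltW // -[(q y)^-1]powR_inv1 ?ltW // -powRrM.
    have -> : (n%:R + 2) / 2 = nu + 1 + 1 :> R by rewrite /nu; field.
    rewrite mulN1r !powRS // (_ : - (nu + 1 + 1) = - nu - 2); last by ring.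
    by ring.
  apply: near_eq_has_lap; apply: filterS nq => w wq.
  rewrite /kelvin /kfac -/(q w) -/nu powRM ?invr_ge0 ?ltW //.
  by rewrite -[(q w)^-1]powR_inv1 ?ltW // -powRrM mulN1r mulrA.
have nuE : n%:R = 2 * nu + 2 :> R by rewrite /nu; field.
clearbody nu.
have pw (r t : R) : 0 < r -> r `^ (t - 1) = r * r `^ (t - 2).
  by move=> r0; rewrite (_ : t - 1 = t - 2 + 1); [exact: powRS|ring].
have D1 z (i : 'I_n) : 0 < q z -> A (inversion z) ->
   is_derive z (evec R i) v (kfac z * partial i u (inversion z) -
    2 * s / q z ^+ 2 * (z - x) ord0 i * Zsum u z).
  by move=> zq zA; apply: (is_derive_comp_inversion i oA).
pose D j k := partial k (partial j u) (inversion y).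
pose b i := partial i u (inversion y).
pose Z i := (y - x) ord0 i.
pose P j := \sum_k Z k * D j k.
pose P' i := \sum_j Z j * D j i.
pose Q := \sum_i Z i * P i.
have QE : \sum_i Z i * P' i = Q.
  exact: quadratic_form_tr.
have EE : Zsum u y = \sum_i Z i * b i by [].
have D2 (i j : 'I_n) : is_derive y (evec R i) (fun z => partial j u (inversion z))
    (kfac y * D j i - 2 * s / q y ^+ 2 * Z i * P j).
  exact: (is_derive_comp_inversion i oA).
have DE (i : 'I_n) : is_derive y (evec R i) (Zsum u)
    (b i + kfac y * P' i - 2 * s / q y ^+ 2 * Z i * Q).
  apply: is_derive_eq.
    apply: is_derive_sumf => j.
    exact: (is_deriveMf (is_derive_coord x y i j) (D2 i j)).
  rewrite big_split /= (sum_delta b i) addrC -addrA; congr (_ + _).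
  rewrite /P' /Q !mulr_sumr -sumrB; apply: eq_bigr => j _.
  rewrite -/(Z j) -/(Z i); move: (Z i) (Z j) (D j i) (P j) => t1 t2 t3 t4.
  by ring.
(* The lowest power that occurs; the others become q and q^2 times p, which leaves a rational
   identity for [field]. *)
pose p := q y `^ (- nu - 3).
have p2 : q y `^ (- nu - 2) = q y * p.
  by rewrite (_ : - nu - 2 = - nu - 3 + 1); [exact: powRS|ring].
have p1 : q y `^ (- nu - 1) = q y * (q y * p).
  rewrite -p2 (_ : - nu - 1 = - nu - 2 + 1); [exact: powRS|ring].
pose h i := s * (q y `^ (- nu - 1) * (kfac y * D i i - 2 * s / q y ^+ 2 * Z i * P i)
                + b i * ((- nu - 1) * q y `^ (- nu - 1 - 1) * (2 * Z i)))
   - 2 * (Z i * (q y `^ (- nu - 2) *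
          (s * (b i + kfac y * P' i - 2 * s / q y ^+ 2 * Z i * Q) +
           nu * (q y * (kfac y * b i - 2 * s / q y ^+ 2 * Z i * Zsum u y) +
                 v y * (2 * Z i))) +
        M y * ((- nu - 2) * q y `^ (- nu - 2 - 1) * (2 * Z i)))
     + (q y `^ (- nu - 2) * M y) * 1).
exists g, h; split.
- apply: filterS2 nq nA => z zq zA i; apply: is_derive_eq.
    by apply: is_deriveMf; [exact: is_derive_sqn_powR|exact: D1].
  rewrite /g /M /kfac -/(q z) -/(v z).
  have q1 : q z != 0 by rewrite gt_eqF.
  have -> : q z `^ (- nu) = q z * q z `^ (- nu - 1).
    by rewrite -{1}[- nu](subrK 1); exact: powRS.
  rewrite -/(q z) (pw _ (- nu) zq).
  move: ((z - x) ord0 i) (Zsum u z) (v z) (q z `^ _) (partial i u _).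
  by move=> t1 t2 t3 t4 t5; field.
- move=> i.
  have dq (t : R) := is_derive_sqn_powR t i q0.
  have dZ : is_derive y (evec R i) (fun z => (z - x) ord0 i) 1.
    by apply: is_derive_eq (is_derive_coord x y i i) _; rewrite eqxx.
  have dM := is_deriveDf (is_deriveZf s (DE i))
    (is_deriveZf nu (is_deriveMf (is_derive_sqn x y i) (D1 y i q0 Ay))).
  exact: (is_deriveBf (is_deriveZf s (is_deriveMf (dq (- nu - 1)) (D2 i i)))
    (is_deriveZf 2 (is_deriveMf dZ (is_deriveMf (dq (- nu - 2)) dM)))).
- have q1 : q y != 0 by rewrite gt_eqF.
  have hE i : h i = s ^+ 2 * q y * p * D i i - 2 * s ^+ 2 * p * (Z i * P i)
     - (4 * nu + 4) * s * q y * p * (Z i * b i) - 2 * s ^+ 2 * p * (Z i * P' i)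
     + (4 * s ^+ 2 * p / q y * Q + 4 * nu * s * p * Zsum u y
        - 4 * nu * q y * p * v y + 4 * (nu + 2) * p * M y) * Z i ^+ 2
     - 2 * q y * p * M y.
    rewrite /h p1 p2 (_ : - nu - 1 - 1 = - nu - 2); last by ring.
    rewrite p2 (_ : - nu - 2 - 1 = - nu - 3); last by ring.
    by rewrite -/p /kfac -/(q y); field.
  have QP : \sum_i Z i * P i = Q := erefl _.
  have qZ : \sum_i Z i ^+ 2 = q y := erefl _.
  have LD : laplacian u (inversion y) = \sum_i D i i := erefl _.
  have ME : M y = s * Zsum u y + nu * (q y * v y) := erefl _.
  apply: esym; apply: (etrans (eq_bigr _ (fun i _ => hE i))).
  apply: (etrans (sum_lincomb _ _ _ _ _ _ (fun i => D i i)
    (fun i => Z i * P i) (fun i => Z i * b i) (fun i => Z i * P' i)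
    (fun i => Z i ^+ 2))).
  clear D2 DE; clearbody D P P' b Z Q p.
  rewrite QP QE -EE qZ nuE LD p2 ME.
  move: (\sum_i D i i) (Zsum u y) (v y) (q y) q1 => t1 t2 t3 t4 q1.
  by field.
Qed.

End Kelvin.

(** * Minimum principle *)

Section MinimumPrinciple.
Context {R : realType} {n : nat}.
Implicit Types (f : 'rV[R]_n -> R) (x y z : 'rV[R]_n).

(** Neither Om outside K nor K outside Om can compete with y0, so a minimum over the compact K lies
    in Om and is a minimum over Om. *)
Lemma attained_min (Om K : set 'rV[R]_n) f (y0 : 'rV[R]_n) :
  compact K -> (forall y, K y -> {for y, continuous f}) -> Om y0 ->
  (forall y, Om y -> ~ K y -> f y0 < f y) ->
  (forall y, K y -> ~ Om y -> f y0 < f y) ->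
  exists2 y, Om y & forall z, Om z -> f y <= f z.
Proof.
move=> cK cf Oy0 hO hK.
have Ky0 : K y0.
  by apply: contrapT => /(hO _ Oy0); rewrite ltxx.
have [|y yK ymin] := @EVT_min_rV R n f K (ex_intro _ y0 Ky0) cK.
  by apply: continuous_in_subspaceT => y /set_mem; exact: cf.
have Ky := set_mem yK.
have yy0 : f y <= f y0 by apply: ymin; exact/mem_set.
exists y.
  by apply: contrapT => /(hK _ Ky); rewrite ltNge yy0.
move=> z Oz; have [Kz|nKz] := pselect (K z).
  by apply: ymin; exact/mem_set.
exact: le_trans yy0 (ltW (hO _ Oz nKz)).
Qed.

(** The sets K encode that the lower limit of f is nonnegative at the boundary and at infinity. A
    negative value would then produce an interior minimum, where the Laplacian cannot be
    negative. *)
Lemma min_principle (Om : set 'rV[R]_n) f :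
  open Om ->
  (forall y, Om y -> exists2 L, L < 0 & has_lap f y L) ->
  (forall e, 0 < e -> exists K, [/\ compact K,
     forall y, K y -> {for y, continuous f},
     forall y, Om y -> ~ K y -> - e < f y &
     forall y, K y -> ~ Om y -> - e < f y]) ->
  forall y, Om y -> 0 <= f y.
Proof.
move=> oO hL hK y0 Oy0; rewrite leNgt; apply/negP => fy0.
have [K [cK cf h1 h2]] := hK (- f y0) ltac:(by rewrite oppr_gt0).
rewrite opprK in h1 h2.
have [y Oy ymin] := attained_min cK cf Oy0 h1 h2.
have [L L0 lap] := hL _ Oy.
suff : 0 <= L by rewrite leNgt L0.
apply: has_lap_min lap _.
by apply: filterS (open_nbhs_nbhs (conj oO Oy)) => z /ymin.
Qed.

Lemma closed_sqn_ge x (r : R) : closed [set y | r <= sqn (y - x)].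
Proof.
apply: (@preimage_closed _ _ (fun y => sqn (y - x)) [set t | r <= t]).
  by move=> y _; exact: continuous_sqnB.
exact: closed_ge.
Qed.

Lemma closed_sqn_le x (r : R) : closed [set y | sqn (y - x) <= r].
Proof.
apply: (@preimage_closed _ _ (fun y => sqn (y - x)) [set t | t <= r]).
  by move=> y _; exact: continuous_sqnB.
exact: closed_le.
Qed.

Lemma compact_sqn_ball x (r : R) : compact [set y | sqn (y - x) <= r].
Proof.
apply: bounded_closed_compact; last exact: closed_sqn_le.
apply: (@sqn_bounded _ _ _ (2 * r + 2 * sqn x)) => y /= h.
by have := sqnD_le (y - x) x; rewrite subrK; lra.
Qed.

Lemma compact_shell x (s r r' : R) :
  compact [set y | s <= sqn (y - x) /\ r <= sqn y <= r'].
Proof.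
have -> : [set y | s <= sqn (y - x) /\ r <= sqn y <= r'] =
  [set y | sqn (y - 0) <= r'] `&`
  ([set y | s <= sqn (y - x)] `&` [set y | r <= sqn (y - 0)]).
  apply/seteqP; split => y /=; rewrite !subr0.
    by move=> [h /andP[]].
  by move=> [-> [-> ->]].
apply: compact_closedI; first exact: compact_sqn_ball.
by apply: closedI; exact: closed_sqn_ge.
Qed.

Lemma open_punctured : open (@punctured R n).
Proof.
have -> : @punctured R n = ~` [set y | sqn (y - 0) <= 0].
  apply/seteqP; split => y /=; rewrite subr0 /punctured /= -sqn_gt0.
    by move=> h; rewrite leNgt h.
  by move=> /negP; rewrite -ltNge.
by apply: closed_openC; exact: closed_sqn_le.
Qed.

Lemma open_exterior x (s : R) : open [set y | s < sqn (y - x)].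
Proof.
have -> : [set y | s < sqn (y - x)] = ~` [set y | sqn (y - x) <= s].
  apply/seteqP; split => y /=; first by move=> h; rewrite leNgt h.
  by move=> /negP; rewrite -ltNge.
by apply: closed_openC; exact: closed_sqn_le.
Qed.

Lemma continuous_powR (q s : R) : 0 < q -> {for q, continuous (fun t : R => t `^ s)}.
Proof.
move=> q0; apply/differentiable_continuous/derivable1_diffP.
by case: (is_derive1_powR s q0).
Qed.

Lemma continuous_sqn_powR x y (s : R) : 0 < sqn (y - x) ->
  {for y, continuous (fun z => sqn (z - x) `^ s)}.
Proof.
move=> q0; apply: (@continuous_comp _ _ _ (fun z => sqn (z - x)) (fun t : R => t `^ s)).
  exact: continuous_sqnB.
exact: continuous_powR.
Qed.

Lemma sqn_inversion x (s : R) y : 0 < sqn (y - x) ->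
  sqn (inversion x s y - x) = s ^+ 2 / sqn (y - x).
Proof.
move=> q0; rewrite /inversion addrC addKr sqnE dotZl dotZr -sqnE /kfac.
by field; rewrite gt_eqF.
Qed.

Lemma continuous_kelvin x (s : R) f y : 0 < s -> 0 < sqn (y - x) ->
  {for inversion x s y, continuous f} -> {for y, continuous (kelvin x s f)}.
Proof.
move=> s0 q0 cf; apply: continuousM.
  apply: (@continuous_comp _ _ _ (kfac x s) (fun t : R => t `^ ((n%:R - 2) / 2))).
    apply: (@continuousM R _ (cst s) (fun z => (sqn (z - x))^-1)).
      exact: cst_continuous.
    by apply: (@continuousV R _ (fun z => sqn (z - x)));
      [exact: lt0r_neq0|exact: continuous_sqnB].
  by apply: continuous_powR; rewrite divr_gt0.
apply: (@continuous_comp _ _ _ (inversion x s) f) => //.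
exact: continuous_inversion.
Qed.

End MinimumPrinciple.

(** * Monotonicity of the Euclidean norm and estimates of the coupling term *)

Section EuclideanNormInequalities.
Context {R : realType} {n : nat}.
Implicit Types (p q : 'rV[R]_n).

Lemma enorm_ge0 p : 0 <= enorm p.
Proof. exact: sqrtr_ge0. Qed.

Lemma enorm_sqr p : enorm p ^+ 2 = sqn p.
Proof. exact: sqr_sqrtr (sqn_ge0 p). Qed.

Lemma enormZ (k : R) p : 0 <= k -> enorm (k *: p) = k * enorm p.
Proof.
move=> k0; rewrite /enorm -!/(sqn _) !sqnE !dotE mulrA -expr2.
by rewrite sqrtrM ?sqr_ge0 // sqrtr_sqr ger0_norm.
Qed.

Lemma coord_le_enorm p i : p ord0 i <= enorm p.
Proof.
apply: le_trans (ler_norm _) _.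
by rewrite -sqrtr_sqr ler_wsqrtr // sqr_coord_le.
Qed.

Lemma enorm_mono p q : (forall j, 0 <= q ord0 j <= p ord0 j) ->
  enorm q <= enorm p.
Proof.
move=> h; rewrite ler_wsqrtr //; apply: ler_sum => j _.
by have /andP[? ?] := h j; rewrite ler_pXn2r // nnegrE; lra.
Qed.

Lemma enorm_strict_mono p q j : (forall j, 0 <= q ord0 j <= p ord0 j) ->
  q ord0 j < p ord0 j -> enorm q < enorm p.
Proof.
move=> h hj; rewrite ltr_sqrt; last first.
  apply: lt_le_trans (sqr_coord_le p j); rewrite exprn_gt0 //.
  by have := h j; lra.
rewrite (bigD1 j) //= [ltRHS](bigD1 j) //= ltr_leD //.
  by have /andP[? ?] := h j; rewrite ltr_pXn2r // nnegrE; lra.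
apply: ler_sum => k _.
by have /andP[? ?] := h k; rewrite ler_pXn2r // nnegrE; lra.
Qed.

End EuclideanNormInequalities.

(** By homogeneity, with t = M / N in [0, 1], this is 1 - t^a <= 4 (1 - t). Since a <= 4 gives t^4
    <= t^a, it is enough to factor 1 - t^4. *)
Lemma powR_lipschitz (R : realType) (a N M : R) : 0 < a <= 4 -> 0 <= M <= N ->
  N * (N `^ a - M `^ a) <= 4 * N `^ a * (N - M).
Proof.
move=> /andP[a0 a4] /andP[M0 MN].
have [N0|N0] := eqVneq N 0.
  have -> : M = 0 by lra.
  by rewrite N0 !subrr !mulr0.
have {}N0 : 0 < N by rewrite lt_def N0 (le_trans M0).
pose t := M / N; have t0 : 0 <= t by rewrite divr_ge0 // ltW.
have t1 : t <= 1 by rewrite ler_pdivrMr // mul1r.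
have Mt : M = t * N by rewrite /t divfK // gt_eqF.
have ta : t ^+ 4 <= t `^ a.
  rewrite -powR_mulrn //; have [->|tn0] := eqVneq t 0.
    by rewrite powR0 // powR_ge0.
  by apply: ger_powR => //; rewrite t1 lt_def tn0 t0.
rewrite {1 2}Mt powRM //; last exact: ltW.
have P0 : 0 <= N `^ a by exact: powR_ge0.
have h : 1 - t `^ a <= 4 * (1 - t).
  apply: le_trans (_ : 1 - t ^+ 4 <= _); first by lra.
  have t2 : t ^+ 2 <= 1 by rewrite expr_le1.
  have -> : 1 - t ^+ 4 = (1 - t) * ((1 + t) * (1 + t ^+ 2)) by ring.
  rewrite mulrC ler_wpM2r ?subr_ge0 //.
  have -> : 4 = 2 * 2 :> R by ring.
  by apply: ler_pM; rewrite ?addr_ge0 ?sqr_ge0 //; lra.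
have -> : N * (N `^ a - t `^ a * N `^ a) = N * N `^ a * (1 - t `^ a) by ring.
have -> : 4 * N `^ a * (N - t * N) = N * N `^ a * (4 * (1 - t)) by ring.
by apply: ler_wpM2l => //; rewrite mulr_ge0 // ltW.
Qed.

(* The bound involves the size of [q] only: [q] will be the Kelvin transform,
   which stays bounded near the origin while [p], the solution, blows up. *)
Lemma nonlinearity_bound (R : realType) (a d : R) (p q : 'rV[R]_2) (i : 'I_2) :
  0 < a <= 4 -> 0 <= d -> (forall j, 0 <= p ord0 j) -> (forall j, 0 <= q ord0 j) ->
  (forall j, q ord0 j <= p ord0 j + d) -> q ord0 i = p ord0 i + d ->
  enorm q `^ a * q ord0 i - enorm p `^ a * p ord0 i <= 9 * enorm q `^ a * d.
Proof.
move=> a04 d0 p0 q0 qp qi.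
(* Each of the two components grows by at most d. *)
have NM : enorm q <= enorm p + 2 * d.
  have e0 : 0 <= enorm p + 2 * d by rewrite addr_ge0 ?enorm_ge0 ?mulr_ge0.
  rewrite -(ler_pXn2r (ltn0Sn 1)) ?nnegrE ?enorm_ge0 //.
  have -> : (enorm p + 2 * d) ^+ 2 = sqn p + 4 * d * enorm p + 4 * d ^+ 2.
    by rewrite -enorm_sqr; ring.
  rewrite enorm_sqr /sqn !big_ord_recl !big_ord0 !addr0.
  have hj j : q ord0 j ^+ 2 <= p ord0 j ^+ 2 + 2 * d * enorm p + d ^+ 2.
    apply: le_trans (_ : (p ord0 j + d) ^+ 2 <= _).
      by rewrite ler_pXn2r ?nnegrE ?addr_ge0.
    have -> : (p ord0 j + d) ^+ 2 = p ord0 j ^+ 2 + 2 * d * p ord0 j + d ^+ 2.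
      by ring.
    by rewrite lerD2r lerD2l ler_wpM2l ?mulr_ge0 // coord_le_enorm.
  have := hj ord0; have := hj (lift ord0 ord0).
  have := sqr_ge0 d; lra.
have P0 : 0 <= enorm q `^ a by exact: powR_ge0.
have piq : p ord0 i <= enorm q.
  by apply: le_trans (coord_le_enorm q i); rewrite qi lerDl.
(* Origin of the 9: the first term counts 1, and the second counts 8, the 4 of [powR_lipschitz]
   times the 2 of [NM]. *)
have -> : enorm q `^ a * q ord0 i - enorm p `^ a * p ord0 i =
  enorm q `^ a * d + p ord0 i * (enorm q `^ a - enorm p `^ a).
  by rewrite qi; ring.
suff h : p ord0 i * (enorm q `^ a - enorm p `^ a) <= 8 * enorm q `^ a * d by lra.
have [MN|NMe] := leP (enorm p) (enorm q); last first.
  apply: le_trans (_ : 0 <= _); last by rewrite !mulr_ge0.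
  apply: mulr_ge0_le0 => //; rewrite subr_le0.
  by apply: ge0_ler_powR; rewrite ?nnegrE ?enorm_ge0 ?ltW //; case/andP: a04.
have Pmono : enorm p `^ a <= enorm q `^ a.
  by apply: ge0_ler_powR; rewrite ?nnegrE ?enorm_ge0 //; case/andP: a04 => /ltW.
apply: le_trans (_ : enorm q * (enorm q `^ a - enorm p `^ a) <= _).
  by apply: ler_wpM2r => //; rewrite subr_ge0.
apply: le_trans (powR_lipschitz a04 _) _; first by rewrite enorm_ge0.
have -> : 8 * enorm q `^ a * d = 4 * enorm q `^ a * (2 * d) by ring.
by apply: ler_wpM2l; [rewrite mulr_ge0|lra].
Qed.

(** * Comparison with the Kelvin transform *)

Section MovingSpheres.
Context {R : realType} {n : nat} (hn : (3 <= n)%N) {U : 'rV[R]_n -> 'rV[R]_2}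
  (hU : nonneg_singular_solution U).
Implicit Types (x y z : 'rV[R]_n) (s : R) (i j : 'I_2).

Local Notation a := (4 / (n%:R - 2) : R).
Local Notation c := (n%:R * (n%:R - 2) / 4 : R).
Local Notation nu := ((n%:R - 2) / 2 : R).
Local Notation u := (component U).

Lemma dim_ge1 : 1 <= n%:R - 2 :> R.
Proof. by have : (3%:R : R) <= n%:R; [rewrite ler_nat|lra]. Qed.

Lemma exponent_bounds : 0 < a <= 4.
Proof.
have h := dim_ge1; have p : 0 < n%:R - 2 :> R by lra.
by apply/andP; split; [rewrite divr_gt0|rewrite ler_pdivrMr //; lra].
Qed.

Lemma coeff_gt0 : 0 < c.
Proof. by have h := dim_ge1; rewrite divr_gt0 // mulr_gt0 //; lra. Qed.

Lemma nu_gt0 : 0 < nu.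
Proof. by have h := dim_ge1; rewrite divr_gt0 //; lra. Qed.

(** This is the criticality of the exponent: the coupling of the transform carries exactly [kfac]
    squared, so the Kelvin transform solves the same system. *)
Lemma nu_exponent : nu * a = 2.
Proof. by have h := dim_ge1; field; rewrite gt_eqF; lra. Qed.

Lemma u_ge0 i y : y != 0 -> 0 <= u i y.
Proof. by move=> y0; have [_ /(_ i y) h _ _] := hU; exact: h. Qed.

Lemma continuous_u i y : y != 0 -> {for y, continuous (u i)}.
Proof. by move=> y0; have [/(_ i) [/(_ y y0) []]] := hU. Qed.

Lemma lap_u i y : y != 0 -> laplacian (u i) y = - (c * enorm (U y) `^ a * u i y).
Proof. by move=> y0; have [_ _ h _] := hU; apply/eqP; rewrite -addr_eq0 h. Qed.

Lemma has_lap_u i y : y != 0 ->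
  has_lap (u i) y (- (c * enorm (U y) `^ a * u i y)).
Proof.
move=> y0; rewrite -lap_u //; have [C2 _ _ _] := hU.
exact: (C2_has_lap (@open_punctured R n)).
Qed.

Definition UK x s y : 'rV[R]_2 := kfac x s y `^ nu *: U (inversion x s y).
Definition wdiff x s i y : R := u i y - UK x s y ord0 i.
Definition exterior x s : set 'rV[R]_n := [set y | s < sqn (y - x) /\ y != 0].

Lemma UKE x s y i : UK x s y ord0 i = kelvin x s (u i) y.
Proof. by rewrite mxE. Qed.

Lemma open_ext x s : open (exterior x s).
Proof. by apply: openI; [exact: open_exterior|exact: open_punctured]. Qed.

Lemma sqn_center_gt0 x s y : 0 < s -> s <= sqn (y - x) -> 0 < sqn (y - x).
Proof. exact: lt_le_trans. Qed.

Lemma kfac_bounds x s y : 0 < s -> s <= sqn (y - x) -> 0 < kfac x s y <= 1.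
Proof.
move=> s0 sq; have q0 := sqn_center_gt0 s0 sq.
by rewrite divr_gt0 //= ler_pdivrMr // mul1r.
Qed.

Lemma inversion_in x s y : 0 < s -> s <= sqn (y - x) ->
  sqn (inversion x s y - x) <= s.
Proof.
move=> s0 sq; rewrite sqn_inversion ?(sqn_center_gt0 s0) //.
rewrite ler_pdivrMr ?(sqn_center_gt0 s0) // expr2.
by rewrite ler_pM2l.
Qed.

Lemma inversion_neq0 x s y : 0 < s < sqn x -> s <= sqn (y - x) ->
  inversion x s y != 0.
Proof.
move=> /andP[s0 sx] sq; apply: contraTneq (inversion_in s0 sq) => ->.
by rewrite sqnBC subr0 -ltNge.
Qed.

Lemma inversion_fix x s y : s = sqn (y - x) -> 0 < s -> inversion x s y = y.
Proof.
move=> -> s0; rewrite /inversion /kfac divff ?gt_eqF // scale1r.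
by rewrite addrC subrK.
Qed.

Lemma wdiff_boundary x s i y : s = sqn (y - x) -> 0 < s -> wdiff x s i y = 0.
Proof.
move=> E s0; rewrite /wdiff UKE /kelvin inversion_fix //.
by rewrite /kfac -E divff ?gt_eqF // powR1 mul1r subrr.
Qed.

Lemma UK_ge0 x s i y : 0 < s < sqn x -> s <= sqn (y - x) ->
  0 <= UK x s y ord0 i.
Proof.
move=> hs sq; rewrite UKE mulr_ge0 ?powR_ge0 //.
by rewrite u_ge0 // inversion_neq0.
Qed.

Lemma enorm_UK_pow x s y : 0 < s -> s <= sqn (y - x) ->
  enorm (UK x s y) `^ a = kfac x s y ^+ 2 * enorm (U (inversion x s y)) `^ a.
Proof.
move=> s0 sq; rewrite enormZ ?powR_ge0 // powRM ?powR_ge0 ?enorm_ge0 //.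
have /andP[/ltW k0 _] := kfac_bounds s0 sq.
by rewrite -powRrM nu_exponent -powR_mulrn.
Qed.

Lemma has_lap_UK x s i y : 0 < s < sqn x -> s <= sqn (y - x) ->
  has_lap (fun z => UK x s z ord0 i) y
   (- (c * enorm (UK x s y) `^ a * UK x s y ord0 i)).
Proof.
move=> hs sq; have /andP[s0 sx] := hs.
have q0 := sqn_center_gt0 s0 sq.
have -> : (fun z => UK x s z ord0 i) = kelvin x s (u i).
  by apply/funext => z; rewrite UKE.
have [C2 _ _ _] := hU.
have iz := inversion_neq0 hs sq.
apply: has_lap_eq.
  exact: (has_lap_kelvin (@open_punctured R n) (C2 i) iz q0 s0).
rewrite lap_u // enorm_UK_pow // UKE /kelvin.
have /andP[k0 _] := kfac_bounds s0 sq.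
have -> : (n%:R + 2) / 2 = nu + 1 + 1 :> R by field.
by rewrite (powRS (nu + 1)) // (powRS nu) //; ring.
Qed.

Lemma has_lap_wdiff x s i y : 0 < s < sqn x -> s <= sqn (y - x) -> y != 0 ->
  has_lap (wdiff x s i) y
   (- (c * (enorm (U y) `^ a * u i y - enorm (UK x s y) `^ a * UK x s y ord0 i))).
Proof.
move=> hs sq y0; apply: has_lap_eq.
  by apply: has_lapB; [exact: has_lap_u|exact: has_lap_UK].
by ring.
Qed.

Lemma continuous_wdiff x s i y : 0 < s < sqn x -> s <= sqn (y - x) -> y != 0 ->
  {for y, continuous (wdiff x s i)}.
Proof.
move=> hs sq y0; have /andP[s0 sx] := hs.
have q0 := sqn_center_gt0 s0 sq.
have -> : wdiff x s i = (fun z => u i z - kelvin x s (u i) z).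
  by apply/funext => z; rewrite /wdiff UKE.
apply: (@continuousB R _ _ (u i) (kelvin x s (u i))).
  exact: continuous_u.
apply: continuous_kelvin => //; apply: continuous_u.
exact: inversion_neq0.
Qed.

(* The point found minimises [wdiff j / phi] over both components [j]; there
   [nonlinearity_bound] controls the coupling, whence the factor 9. *)
Lemma comparison x s (B : R) (phi Lphi : 'rV[R]_n -> R) :
  0 < s < sqn x -> (forall z, sqn (z - x) <= s -> enorm (U z) <= B) ->
  (forall y, y != 0 -> s <= sqn (y - x) ->
     {for y, continuous phi} /\ 1 + sqn y `^ (- (1 / 4)) <= phi y) ->
  (forall y, exterior x s y -> has_lap phi y (- Lphi y)) ->
  forall i0 y0, exterior x s y0 -> wdiff x s i0 y0 < 0 ->
  exists i y, [/\ exterior x s y, wdiff x s i y < 0 &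
    Lphi y <= 9 * c * B `^ a * (kfac x s y ^+ 2 * phi y)].
Proof.
move=> hs hB hphi hlap i0 y0 Ey0 w0; have /andP[s0 sx] := hs.
have B0 : 0 <= B by apply: le_trans (enorm_ge0 _) (hB x _); rewrite subrr sqn0 ltW.
pose w := wdiff x s.
pose f y := Num.min (w ord0 y) (w (lift ord0 ord0) y) / phi y.
have phi1 y : y != 0 -> s <= sqn (y - x) -> 1 <= phi y.
  move=> h1 h2; have [_] := hphi y h1 h2; apply: le_trans.
  by rewrite lerDl powR_ge0.
have min_le i y : Num.min (w ord0 y) (w (lift ord0 ord0) y) <= w i y.
  by case: (unliftP ord0 i) => [k ->|->]; rewrite ?(ord1 k) ge_min lexx ?orbT.
have fE y : exists i, f y = w i y / phi y.
  by rewrite /f; case: leP => _; [exists ord0|exists (lift ord0 ord0)].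
(* Only the transform can make the difference negative, because U is nonnegative. *)
have wlow i y : y != 0 -> s <= sqn (y - x) -> - (kfac x s y `^ nu * B) <= w i y.
  move=> h1 h2; rewrite /w /wdiff; have := u_ge0 i h1.
  have : UK x s y ord0 i <= kfac x s y `^ nu * B; last by lra.
  apply: le_trans (coord_le_enorm _ _) _; rewrite enormZ ?powR_ge0 //.
  by apply: ler_wpM2l; [exact: powR_ge0|apply: hB; exact: inversion_in].
have flow y : y != 0 -> s <= sqn (y - x) -> - (kfac x s y `^ nu * B / phi y) <= f y.
  move=> h1 h2; have [i ->] := fE y; rewrite -mulNr ler_pM2r; first exact: wlow.
  by rewrite invr_gt0 (lt_le_trans ltr01) // phi1.
have fy0 : f y0 < 0.
  case: Ey0 => h1 h2; rewrite /f pmulr_llt0.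
    exact: le_lt_trans (min_le _ _) w0.
  by rewrite invr_gt0 (lt_le_trans ltr01) // phi1 // ltW.
pose e := - f y0; have e0 : 0 < e by rewrite oppr_gt0.
have B1 : 0 < B + 1 by lra.
(* The constants make f larger than -e off K. If |y|^2 < r then |y|^(1/2) < t, and phi >= |y|^(-1/2)
   brings the lower bound down to B t. If |y|^2 > r' then |y - x|^2 > s / k0, so [kfac] < k0 and its
   power nu is below t. *)
pose t := e / (B + 1); have t0 : 0 < t by rewrite divr_gt0.
have tB : B * t < e.
  by rewrite /t mulrA ltr_pdivrMr // mulrC ltr_pM2l //; lra.
pose r : R := t `^ 4.
pose k0 : R := t `^ (nu^-1); have k00 : 0 < k0 by rewrite powR_gt0.
pose r' : R := 2 * (s / k0) + 2 * sqn x.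
pose K := [set y | s <= sqn (y - x) /\ r <= sqn y <= r'].
have r0 : 0 < r by rewrite powR_gt0.
have Kneq0 y : K y -> y != 0 by move=> [_ /andP[h _]]; rewrite -sqn_gt0 (lt_le_trans r0).
have [y [Ey1 Ey2] ymin] : exists2 y, exterior x s y &
    forall z, exterior x s z -> f y <= f z.
  apply: (@attained_min _ _ (exterior x s) K f y0) => //.
  - exact: compact_shell.
  - move=> y Ky; have y0' := Kneq0 y Ky; have [sq _] := Ky.
    have [cphi _] := hphi y y0' sq.
    apply: (@continuousM R _ (fun y => Num.min (w ord0 y) (w (lift ord0 ord0) y))).
      by apply: continuous_min; exact: continuous_wdiff.
    apply: continuousV => //; rewrite gt_eqF // (lt_le_trans ltr01) //.
    exact: phi1.
  - move=> y [/ltW sq y0'] nK.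
    apply: lt_le_trans (flow y y0' sq); rewrite -[f y0]opprK ltrN2 -/e.
    have p0 := lt_le_trans ltr01 (phi1 _ y0' sq).
    rewrite ltr_pdivrMr //.
    have /andP[k1 k2] := kfac_bounds s0 sq.
    have kn1 : kfac x s y `^ nu <= 1.
      have E1 : (1 : R) `^ nu = 1 by rewrite powR1.
      rewrite -[leRHS]E1; apply: (ge0_ler_powR (ltW nu_gt0)) k2.
        by rewrite nnegrE ltW.
      by rewrite nnegrE.
    have [_ phi2] := hphi y y0' sq.
    have [ry|ry] := ltP (sqn y) r.
      have kB : kfac x s y `^ nu * B <= B by have := ler_wpM2r B0 kn1; rewrite mul1r.
      apply: le_lt_trans kB _.
      have q0 : 0 < sqn y by rewrite sqn_gt0.
      have st : sqn y `^ (1 / 4) < t.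
        have -> : t = r `^ (1 / 4).
          by rewrite /r -powRrM (_ : 4 * (1 / 4) = 1) ?powRr1 ?ltW //; field.
        by apply: gt0_ltr_powR; rewrite ?nnegrE ?ltW // divr_gt0.
      have P0 : 0 < sqn y `^ (1 / 4) by rewrite powR_gt0.
      have : B * sqn y `^ (1 / 4) < e.
        by apply: le_lt_trans tB; rewrite ler_wpM2l // ltW.
      rewrite -ltr_pdivlMr // -powRN => /lt_le_trans; apply.
      by rewrite ler_pM2l //; lra.
    have ry' : r' < sqn y.
      by rewrite ltNge; apply/negP => h; apply: nK; split=> //; rewrite ry h.
    have q0 := sqn_center_gt0 s0 sq.
    have kk : kfac x s y < k0.
      rewrite ltr_pdivrMr // mulrC -ltr_pdivrMr //.
      by have := sqnD_le (y - x) x; rewrite subrK; move: ry'; rewrite /r'; lra.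
    have kt : kfac x s y `^ nu < t.
      have -> : t = k0 `^ nu.
        by rewrite /k0 -powRrM mulVf ?powRr1 ?ltW // gt_eqF // nu_gt0.
      by apply: gt0_ltr_powR; rewrite ?nnegrE ?ltW // nu_gt0.
    have kB : kfac x s y `^ nu * B <= B * t by rewrite mulrC ler_wpM2l // ltW.
    apply: le_lt_trans kB _.
    by apply: lt_le_trans tB _; apply: ler_peMr; [exact: ltW|exact: phi1].
  (* Points of K outside the exterior lie on the sphere itself, where the difference vanishes. *)
  - move=> y Ky nE; have y0' := Kneq0 y Ky; have [sq _] := Ky.
    have E : s = sqn (y - x).
      apply/eqP; rewrite eq_le sq /= leNgt; apply/negP => h.
      by apply: nE; split.
    by have [j ->] := fE y; rewrite /w wdiff_boundary // mul0r.
have [i Ei] := fE y; have sq := ltW Ey1.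
have p0 := lt_le_trans ltr01 (phi1 _ Ey2 sq).
pose m := - f y; have m0 : 0 < m.
  by rewrite oppr_gt0; apply: le_lt_trans fy0; apply: ymin.
have wiE : w i y = - (m * phi y) by rewrite /m Ei mulNr divfK ?opprK // gt_eqF.
have wm j z : exterior x s z -> - (m * phi z) <= w j z.
  move=> Ez; have [Ez1 Ez2] := Ez.
  have pz := lt_le_trans ltr01 (phi1 _ Ez2 (ltW Ez1)).
  have := ymin z Ez; rewrite -[f y]opprK -/m /f ler_pdivlMr // mulNr => /le_trans.
  by apply; exact: min_le.
exists i, y; split => //.
  by rewrite -/(w i y) wiE oppr_lt0 mulr_gt0.
(* The function w_i + m phi vanishes at y and is nonnegative in the exterior, so its Laplacian at y
   is nonnegative. *)
have lap := has_lapD (has_lap_wdiff i hs sq Ey2) (has_lapZ m (hlap y (conj Ey1 Ey2))).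
have := has_lap_min lap _; have {}lap := I.
have nmin : \forall z \near y, wdiff x s i y + m * phi y <= wdiff x s i z + m * phi z.
  have oE : open_nbhs y (exterior x s) by split; [exact: open_ext|split].
  apply: filterS (open_nbhs_nbhs oE) => z Ez.
  by rewrite -/(w i y) wiE addNr; have := wm i z Ez; rewrite /w; lra.
move=> /(_ nmin).
have d0 : 0 <= m * phi y by rewrite mulr_ge0 ?ltW.
(* Minimality over both components gives q_j <= p_j + d for every j with the same d = m phi(y), with
   equality for j = i. *)
have nb := @nonlinearity_bound R a (m * phi y) (U y) (UK x s y) i exponent_bounds d0
  (fun j => u_ge0 j Ey2) (fun j => UK_ge0 j hs sq) _ _.
have {}nb : enorm (UK x s y) `^ a * UK x s y ord0 i - enorm (U y) `^ a * u i y <=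
    9 * enorm (UK x s y) `^ a * (m * phi y).
  apply: nb => [j|].
    by have := wm j y (conj Ey1 Ey2); rewrite /w /wdiff /component; lra.
  by move: wiE; rewrite /w /wdiff /component; lra.
have PB : enorm (UK x s y) `^ a <= kfac x s y ^+ 2 * B `^ a.
  rewrite enorm_UK_pow //; apply: ler_wpM2l; first exact: sqr_ge0.
  apply: ge0_ler_powR; rewrite ?nnegrE ?enorm_ge0 //.
    by have /andP[/ltW] := exponent_bounds.
  by apply: hB; exact: inversion_in.
have c0 := coeff_gt0.
move=> h; rewrite -(ler_pM2l m0).
have h1 : m * Lphi y <= c * (9 * enorm (UK x s y) `^ a * (m * phi y)).
  apply: le_trans (ler_wpM2l (ltW c0) nb); lra.
apply: le_trans h1 _.
have -> : m * (9 * c * B `^ a * (kfac x s y ^+ 2 * phi y)) =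
  c * (9 * (kfac x s y ^+ 2 * B `^ a) * (m * phi y)) by ring.
by rewrite ler_wpM2l ?(ltW c0) // ler_wpM2r // ler_wpM2l.
Qed.

End MovingSpheres.

Arguments UK {R n} U x s y.
Arguments wdiff {R n} U x s i y.

(** * Barriers and strict positivity *)

Section Barriers.
Context {R : realType} {n : nat} (hn : (3 <= n)%N).
Implicit Types (v : 'rV[R]_n -> R) (x y z : 'rV[R]_n).

Local Notation nu := ((n%:R - 2) / 2 : R).

Lemma nbhs_sqn_ball x (P : 'rV[R]_n -> Prop) : (\forall y \near x, P y) ->
  exists2 r, 0 < r & forall y, sqn (y - x) <= r -> P y.
Proof.
move=> /nbhs_ballP [e /= e0 he]; exists ((e / 2) ^+ 2).
  by rewrite exprn_gt0 // divr_gt0.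
move=> y hy; apply: he; rewrite -ball_normE /= distrC.
have h : `|y - x| <= e / 2.
  have e2 : 0 <= e / 2 by rewrite divr_ge0 // ltW.
  rewrite -(@ler_pXn2r _ 2) ?nnegrE //.
  exact: le_trans (normr_sqr_le _) hy.
by apply: le_lt_trans h _; rewrite ltr_pdivrMr // ltr_pMr // ltr1n.
Qed.

Lemma continuous_sqn_powR0 y (s : R) : y != 0 ->
  {for y, continuous (fun z => sqn z `^ s)}.
Proof.
move=> y0; apply: (@continuous_comp _ _ _ sqn (fun t : R => t `^ s)).
  exact: continuous_sqn.
by apply: continuous_powR; rewrite sqn_gt0.
Qed.

Lemma powRN_decay (p eps e : R) : 0 < p -> 0 <= eps -> 0 < e ->
  exists2 k, 0 < k & forall q, k < q -> eps * q `^ (- p) < e.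
Proof.
move=> p0 eps0 e0; have E0 : 0 < eps / e + 1.
  by rewrite ltr_wpDl // divr_ge0 // ltW.
exists ((eps / e + 1) `^ p^-1); first by rewrite powR_gt0.
move=> q kq; have q0 : 0 < q by apply: lt_trans kq; rewrite powR_gt0.
have h : eps / e + 1 < q `^ p.
  have -> : eps / e + 1 = ((eps / e + 1) `^ p^-1) `^ p.
    by rewrite -powRrM mulVf ?powRr1 ?ltW // gt_eqF.
  apply: (gt0_ltr_powR p0) => //; first by rewrite nnegrE powR_ge0.
  by rewrite nnegrE ltW.
have qn0 : 0 < q `^ p by rewrite powR_gt0.
rewrite powRN ltr_pdivrMr // mulrC -ltr_pdivrMr //.
by apply: lt_trans h; rewrite ltrDl.
Qed.

Lemma powRN_blowup (M eta : R) : 0 <= M -> 0 < eta ->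
  exists2 r, 0 < r & forall q, 0 < q <= r -> M <= eta * q `^ (- (1 / 4)).
Proof.
move=> M0 eta0; have p0 : 0 < eta / (M + 1) by rewrite divr_gt0 // ltr_wpDl.
exists ((eta / (M + 1)) `^ 4); first by rewrite powR_gt0.
move=> q /andP[q0 qr].
have h : q `^ (1 / 4) <= eta / (M + 1).
  have -> : eta / (M + 1) = ((eta / (M + 1)) `^ 4) `^ (1 / 4).
    by rewrite -powRrM (_ : 4 * (1 / 4) = 1) ?powRr1 ?ltW //; field.
  have f0 : 0 <= 1 / 4 :> R by rewrite divr_ge0.
  apply: (ge0_ler_powR f0) => //; first by rewrite nnegrE ltW.
  by rewrite nnegrE powR_ge0.
have qn0 : 0 < q `^ (1 / 4) by rewrite powR_gt0.
rewrite powRN ler_pdivlMr //.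
move: h; rewrite ler_pdivlMr ?ltr_wpDl // mulrDr mulr1 mulrC; lra.
Qed.

Lemma dim_ge3 : 3 <= n%:R :> R.
Proof. by rewrite ler_nat. Qed.

(* [|y|^(-1/2)] is strictly superharmonic since [1/2 < n - 2]; it absorbs the
   singularity at the origin and makes the inequalities strict. *)
Lemma has_lap_singular y : y != 0 ->
  has_lap (fun z => sqn z `^ (- (1 / 4))) y
    (- ((n%:R - 5 / 2) / 2 * sqn y `^ (- (1 / 4) - 1))).
Proof.
move=> y0; have q0 : 0 < sqn (y - 0) by rewrite subr0 sqn_gt0.
have := has_lap_sqn_powR (- (1 / 4)) q0; rewrite subr0.
have -> : (fun z : 'rV[R]_n => sqn (z - 0) `^ (- (1 / 4))) =
          (fun z => sqn z `^ (- (1 / 4))).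
  by apply/funext => z; rewrite subr0.
by move=> h; apply: has_lap_eq h _; field.
Qed.

Lemma has_lap_fundamental x y : 0 < sqn (y - x) ->
  has_lap (fun z => sqn (z - x) `^ (- nu)) y 0.
Proof.
move=> q0; apply: has_lap_eq (has_lap_sqn_powR _ q0) _.
by rewrite (_ : 2 * - nu - 2 + n%:R = 0) ?mulr0 ?mul0r //; field.
Qed.

(** Adding eta |y|^(-1/2) makes v strictly superharmonic and lets the boundary conditions ignore
    bounded losses near the origin; eta is arbitrary, so it disappears at the end. *)
Lemma barrier (Om : set 'rV[R]_n) v :
  open Om -> (forall y, Om y -> y != 0) ->
  (forall y, Om y -> exists2 L, L <= 0 & has_lap v y L) ->
  (forall e eta, 0 < e -> 0 < eta -> exists K, [/\ compact K,
     forall y, K y -> y != 0 /\ {for y, continuous v},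
     forall y, Om y -> ~ K y -> - e < v y + eta * sqn y `^ (- (1 / 4)) &
     forall y, K y -> ~ Om y -> - e < v y + eta * sqn y `^ (- (1 / 4))]) ->
  forall y, Om y -> 0 <= v y.
Proof.
move=> oO On0 hL hK.
suff main eta : 0 < eta ->
    forall y, Om y -> 0 <= v y + eta * sqn y `^ (- (1 / 4)).
  move=> y Oy; apply/ler_addgt0Pr => t t0.
  have q0 : 0 < sqn y `^ (- (1 / 4)) by rewrite powR_gt0 // sqn_gt0 On0.
  have := main (t / sqn y `^ (- (1 / 4))) (divr_gt0 t0 q0) y Oy.
  by rewrite divfK // gt_eqF.
move=> eta0; apply: min_principle => // [y Oy|e e0].
  have [L L0 lv] := hL y Oy; have y0 := On0 y Oy.
  exists (L + eta * (- ((n%:R - 5 / 2) / 2 * sqn y `^ (- (1 / 4) - 1)))).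
    rewrite mulrN; have h3 := dim_ge3.
    suff : 0 < eta * ((n%:R - 5 / 2) / 2 * sqn y `^ (- (1 / 4) - 1)) by lra.
    by rewrite mulr_gt0 // mulr_gt0 ?powR_gt0 ?sqn_gt0 // divr_gt0 //; lra.
  apply: has_lapD => //; apply: has_lapZ; exact: has_lap_singular.
have [K [cK cv h1 h2]] := hK e eta e0 eta0; exists K; split => // y Ky.
have [y0 cvy] := cv y Ky.
apply: continuousD => //; apply: (@continuousM R _ (cst eta)).
  exact: cst_continuous.
exact: continuous_sqn_powR0.
Qed.

End Barriers.

Section Positivity.
Context {R : realType} {n : nat} (hn : (3 <= n)%N) {U : 'rV[R]_n -> 'rV[R]_2}
  (hU : nonneg_singular_solution U).
Implicit Types (x y z : 'rV[R]_n) (s : R) (i j : 'I_2).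

Local Notation a := (4 / (n%:R - 2) : R).
Local Notation c := (n%:R * (n%:R - 2) / 4 : R).
Local Notation nu := ((n%:R - 2) / 2 : R).
Local Notation u := (component U).

(** A strong maximum principle in a single step: from a ball on which u_i > m, compare with a
    multiple of the fundamental solution with pole at its centre z. This multiple is positive
    everywhere, so no chain of balls is required. *)
Lemma u_zero_or_pos i :
  (forall y, y != 0 -> u i y = 0) \/ (forall y, y != 0 -> 0 < u i y).
Proof.
have [[z [z0 uz]]|none] := pselect (exists z, z != 0 /\ 0 < u i z); last first.
  left=> y y0; apply/eqP; rewrite eq_le (u_ge0 hU) // andbT leNgt.
  by apply/negP => h; apply: none; exists y.
right; pose m := u i z / 2; have m0 : 0 < m by rewrite divr_gt0.
have zp : 0 < sqn z by rewrite sqn_gt0.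
have [r r0 hr] : exists2 r, 0 < r & forall y, sqn (y - z) <= r ->
    m < u i y /\ y != 0.
  have um : m < u i z by rewrite /m ltr_pdivrMr // ltr_pMr // ltr1n.
  have [r r0 hr] := nbhs_sqn_ball (cvgr_gt _ (continuous_u hU z0) _ um).
  exists (Num.min r (sqn z / 2)) => [|y]; first by rewrite lt_min r0 divr_gt0.
  rewrite le_min => /andP[/hr h1 h2]; split => //.
  apply: contraTneq h2 => ->; rewrite sqnBC subr0 -ltNge.
  by rewrite ltr_pdivrMr // ltr_pMr // ltr1n.
move=> y y0; have [yr|ry] := leP (sqn (y - z)) r.
  by have [h _] := hr _ yr; apply: lt_trans h.
(* Chosen so that the comparison function equals m on the sphere of squared radius r. *)
pose eps := m * r `^ nu; have eps0 : 0 < eps by rewrite mulr_gt0 // powR_gt0.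
have nu0 := nu_gt0 hn (R := R).
have epsr : eps * r `^ (- nu) = m.
  by rewrite /eps powRN mulfK // gt_eqF // powR_gt0.
have Pr q : r <= q -> eps * q `^ (- nu) <= m.
  move=> rq; rewrite -epsr ler_pM2l // !powRN lef_pV2 ?posrE ?powR_gt0 //; last first.
    exact: lt_le_trans rq.
  apply: (ge0_ler_powR (ltW nu0)) => //; rewrite nnegrE ltW //.
  exact: lt_le_trans rq.
pose v w := u i w - eps * sqn (w - z) `^ (- nu).
suff : 0 <= v y.
  rewrite subr_ge0; apply: lt_le_trans; rewrite mulr_gt0 // powR_gt0 //.
  exact: lt_trans ry.
apply: (@barrier _ _ hn (exterior z r) v) => //.
- exact: open_ext.
- by move=> w [].
- move=> w [w1 w2].
  exists (- (c * enorm (U w) `^ a * u i w) - eps * 0).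
    rewrite mulr0 subr0 oppr_le0 mulr_ge0 ?(u_ge0 hU) // mulr_ge0 ?powR_ge0 //.
    exact: ltW (coeff_gt0 hn).
  apply: has_lapB; first exact: has_lap_u.
  by apply: has_lapZ; apply: has_lap_fundamental; exact: lt_trans w1.
- move=> e eta e0 eta0.
  (* Far out the comparison function is below e; near the origin eta |w|^(-1/2) is at least m and
     thus dominates it. *)
  have [k k0 hk] := powRN_decay (nu_gt0 hn) (ltW eps0) e0.
  have [rho rho0 hrho] := powRN_blowup (ltW m0) eta0.
  exists [set y | r <= sqn (y - z) /\ rho <= sqn y <= 2 * k + 2 * sqn z]; split.
  + exact: compact_shell.
  + move=> w [w1 /andP[w2 _]]; have w0 : w != 0.
      by rewrite -sqn_gt0; exact: lt_le_trans w2.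
    split=> //; apply: (@continuousB R _ _ (u i)); first exact: continuous_u.
    apply: (@continuousM R _ (cst eps)); first exact: cst_continuous.
    by apply: continuous_sqn_powR; exact: lt_le_trans w1.
  + move=> w [w1 w0] nK; have uw := u_ge0 hU i w0.
    have P0 : 0 <= eta * sqn w `^ (- (1 / 4)) by rewrite mulr_ge0 ?powR_ge0 // ltW.
    have [w2|w2] := leP (sqn w) rho.
      have := hrho (sqn w); rewrite w2 sqn_gt0 w0 => /(_ isT).
      by have := Pr _ (ltW w1); rewrite /v; lra.
    have : k < sqn (w - z).
      have := sqnD_le (w - z) z; rewrite subrK => h.
      rewrite ltNge; apply/negP => h'; apply: nK; split; first exact: ltW.
      by rewrite (ltW w2) /=; lra.
    by move=> /hk; rewrite /v; lra.
  + move=> w [w1 /andP[w2 _]] nO.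
    have w0 : w != 0 by rewrite -sqn_gt0; exact: lt_le_trans w2.
    have wr : sqn (w - z) <= r.
      by rewrite leNgt; apply/negP => h; apply: nO.
    have P0 : 0 <= eta * sqn w `^ (- (1 / 4)) by rewrite mulr_ge0 ?powR_ge0 // ltW.
    have [h _] := hr _ wr; have := Pr _ w1; rewrite /v; lra.
Qed.

Definition good x s := forall i y, exterior x s y -> 0 <= wdiff U x s i y.

Lemma enorm_le_sum (p : 'rV[R]_2) : (forall i, 0 <= p ord0 i) ->
  enorm p <= p ord0 ord0 + p ord0 (lift ord0 ord0).
Proof.
move=> h; have h0 := h ord0; have h1 := h (lift ord0 ord0).
rewrite -(ger0_norm (addr_ge0 h0 h1)) -sqrtr_sqr ler_wsqrtr //.
rewrite !big_ord_recl big_ord0 addr0 sqrrD -addrA lerD2l lerDr.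
by rewrite mulrn_wge0 // mulr_ge0.
Qed.

Lemma ball_bound x s : s < sqn x ->
  exists2 B, 0 <= B & forall z, sqn (z - x) <= s -> enorm (U z) <= B.
Proof.
move=> sx; have nz z : sqn (z - x) <= s -> z != 0.
  move=> h; apply: contraTneq h => ->.
  by rewrite sqnBC subr0 -ltNge.
have [s0|s0] := ltP s 0.
  by exists 0 => // z; rewrite leNgt (lt_le_trans s0) // sqn_ge0.
pose K := [set y | sqn (y - x) <= s].
pose f z := u ord0 z + u (lift ord0 ord0) z.
have Kx : K x by rewrite /K /= subrr sqn0.
have [|b /set_mem Kb hb] := @EVT_max_rV _ n f K (ex_intro _ x Kx) (@compact_sqn_ball _ _ x s).
  apply: continuous_in_subspaceT => y /set_mem Ky.
  by apply: continuousD; apply: (continuous_u hU); exact: nz.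
exists (f b) => [|z Kz].
  by rewrite addr_ge0 ?(u_ge0 hU) // nz.
apply: le_trans (hb z (mem_set Kz)).
by apply: enorm_le_sum => i; apply: (u_ge0 hU); exact: nz.
Qed.

Lemma UK_le x s i y B : 0 < s < sqn x -> s <= sqn (y - x) -> 0 <= B ->
  (forall z, sqn (z - x) <= s -> enorm (U z) <= B) -> UK U x s y ord0 i <= B.
Proof.
move=> /andP[s0 sx] sq B0 hB; apply: le_trans (coord_le_enorm _ _) _.
rewrite enormZ ?powR_ge0 //.
have /andP[k0 k1] := kfac_bounds s0 sq.
have k2 : kfac x s y `^ nu <= 1.
  have E1 : (1 : R) `^ nu = 1 by rewrite powR1.
  rewrite -[leRHS]E1; apply: (ge0_ler_powR (ltW (nu_gt0 hn))) k1.
    by rewrite nnegrE ltW.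
  by rewrite nnegrE.
have := ler_wpM2r B0 k2; rewrite mul1r; apply: le_trans.
by apply: ler_wpM2l; [exact: powR_ge0|apply: hB; exact: inversion_in].
Qed.

Lemma enorm_UK_le x s y : good x s -> 0 < s < sqn x -> exterior x s y ->
  enorm (UK U x s y) <= enorm (U y).
Proof.
move=> g hs Ey; apply: enorm_mono => i.
rewrite (UK_ge0 hU _ hs (ltW Ey.1)) /=.
by have := g i y Ey; rewrite /wdiff subr_ge0.
Qed.

(* The barrier is the Green function of the exterior of the sphere with pole at
   the origin. *)
Lemma wdiff_sum_gt0 x s y : good x s -> 0 < s < sqn x -> exterior x s y ->
  0 < wdiff U x s ord0 y + wdiff U x s (lift ord0 ord0) y.
Proof.
move=> g hs Ey; have /andP[s0 sx] := hs.
have [B B0 hB] := ball_bound sx.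
pose W z := wdiff U x s ord0 z + wdiff U x s (lift ord0 ord0) z.
(* Each component of the transform is at most B and |U| <= u_1 + u_2, so |U| > 2 B + 1 is enough. *)
have [rho rho0 hrho] : exists2 rho, 0 < rho & forall z, z != 0 ->
    s <= sqn (z - x) -> sqn z <= rho -> 1 <= W z.
  have [_ _ _ bl] := hU.
  have nb : nbhs (0 : 'rV[R]_n) (fun z => z != 0 -> 2 * B + 1 < enorm (U z)).
    exact: (cvgry_gt bl (2 * B + 1)).
  have [r r0 hr] := nbhs_sqn_ball nb; exists r => // z z0 sz zr.
  have := hr z; rewrite subr0 => /(_ zr z0).
  have := enorm_le_sum (fun i => u_ge0 hU i z0 : 0 <= U z ord0 i).
  have := UK_le ord0 hs sz B0 hB; have := UK_le (lift ord0 ord0) hs sz B0 hB.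
  rewrite /W /wdiff /component; lra.
have [y1 y0] := Ey; have [ry|ry] := leP (sqn y) rho.
  by apply: lt_le_trans ltr01 _; apply: hrho => //; exact: ltW.
have X0 : 0 < sqn x by exact: lt_trans sx.
(* The point be x is the inverse of the origin in the sphere. The identity [apo] shows that the
   sphere is the Apollonius set |z - be x|^2 = th |z|^2, so G vanishes on it and is positive
   outside. *)
pose th := s / sqn x; have th0 : 0 < th by rewrite divr_gt0.
pose be := 1 - th; have be0 : 0 < be.
  by rewrite subr_gt0 ltr_pdivrMr // mul1r.
have apo z : sqn (z - be *: x) = th * sqn z + be * (sqn (z - x) - s).
  rewrite !sqnB dotZr (sqnE (be *: x)) dotZl dotZr -sqnE.
  have -> : s = th * sqn x by rewrite divfK // gt_eqF.
  by rewrite /be; ring.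
have nu0 := nu_gt0 hn (R := R).
pose G z := sqn z `^ (- nu) - th `^ nu * sqn (z - be *: x) `^ (- nu).
have GE z : G z = sqn z `^ (- nu) - th `^ nu * (th * sqn z + be * (sqn (z - x) - s)) `^ (- nu).
  by rewrite /G apo.
have thE q : 0 <= q -> q `^ (- nu) = th `^ nu * (th * q) `^ (- nu).
  move=> q0; rewrite powRM ?(ltW th0) // mulrA [_ `^ (- nu) in RHS]powRN divff ?mul1r //.
  by rewrite gt_eqF // powR_gt0.
have Gpos z : exterior x s z -> 0 < G z.
  move=> [z1 z0]; have q0 : 0 < sqn z by rewrite sqn_gt0.
  rewrite GE subr_gt0 (thE (sqn z)) ?(ltW q0) // ltr_pM2l ?powR_gt0 //.
  have t0 : 0 < th * sqn z by rewrite mulr_gt0.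
  have t1 : th * sqn z < th * sqn z + be * (sqn (z - x) - s).
    by rewrite ltrDl mulr_gt0 // subr_gt0.
  have t2 := lt_trans t0 t1.
  rewrite !powRN ltf_pV2 ?posrE ?powR_gt0 //.
  by apply: (gt0_ltr_powR nu0) => //; rewrite nnegrE ltW.
have Gle z : G z <= sqn z `^ (- nu).
  by rewrite /G lerBlDr lerDl mulr_ge0 // powR_ge0.
have Gbd z : sqn (z - x) = s -> G z = 0.
  by move=> E; rewrite GE E subrr mulr0 addr0 -thE ?sqn_ge0 // subrr.
(* Normalised so that eps G <= 1 <= W where |z|^2 = rho; the smaller ball is cut out of [Om]. *)
pose eps := rho `^ nu; have eps0 : 0 < eps by rewrite powR_gt0.
pose v z := W z - eps * G z.
have qbe z : z != 0 -> s <= sqn (z - x) -> 0 < sqn (z - be *: x).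
  move=> z0 sz; rewrite apo ltr_pwDl //; first by rewrite mulr_gt0 // sqn_gt0.
  by apply: mulr_ge0; [exact: ltW|rewrite subr_ge0].
pose Om := exterior x s `&` [set z | rho < sqn (z - 0)].
suff : 0 <= v y.
  by rewrite subr_ge0; apply: lt_le_trans; rewrite mulr_gt0 // Gpos.
apply: (@barrier _ _ hn Om v).
- by apply: openI; [exact: open_ext|exact: open_exterior].
- by move=> z [[]].
- move=> z [[z1 z0] _].
  pose N i := c * (enorm (U z) `^ a * u i z - enorm (UK U x s z) `^ a * UK U x s z ord0 i).
  have N0 i : 0 <= N i.
    apply: mulr_ge0; first exact: ltW (coeff_gt0 hn).
    rewrite subr_ge0; apply: ler_pM; rewrite ?powR_ge0 ?(UK_ge0 hU _ hs (ltW z1)) //.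
      have /andP[a0 _] := exponent_bounds hn (R := R).
      apply: (ge0_ler_powR (ltW a0)); rewrite ?nnegrE ?enorm_ge0 //.
      exact: enorm_UK_le.
    by have := g i z (conj z1 z0); rewrite /wdiff subr_ge0.
  exists ((- N ord0 + - N (lift ord0 ord0)) - eps * (0 - th `^ nu * 0)).
    by have := N0 ord0; have := N0 (lift ord0 ord0); rewrite !mulr0 subrr mulr0; lra.
  apply: has_lapB.
    by apply: has_lapD; apply: has_lap_wdiff => //; exact: ltW.
  apply: has_lapZ; apply: has_lapB.
    have q0 : 0 < sqn (z - 0) by rewrite subr0 sqn_gt0.
    have := has_lap_fundamental q0.
    by congr (has_lap _ _ _); apply/funext => t; rewrite subr0.
  by apply: has_lapZ; apply: has_lap_fundamental; apply: qbe => //; exact: ltW.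
- move=> e eta e0 eta0.
  have [k k0 hk] := powRN_decay (nu_gt0 hn) (ltW eps0) e0.
  exists [set y | s <= sqn (y - x) /\ rho <= sqn y <= k]; split.
  + exact: compact_shell.
  + move=> z [z1 /andP[z2 _]]; have z0 : z != 0.
      by rewrite -sqn_gt0; exact: lt_le_trans z2.
    split=> //; apply: (@continuousB R _ _ W).
      by apply: continuousD; exact: continuous_wdiff.
    apply: (@continuousM R _ (cst eps)); first exact: cst_continuous.
    apply: (@continuousB R _ _ (fun z => sqn z `^ (- nu))).
      exact: continuous_sqn_powR0.
    apply: (@continuousM R _ (cst (th `^ nu))); first exact: cst_continuous.
    by apply: continuous_sqn_powR; exact: qbe.
  + move=> z [[z1 z0] z2] nK; rewrite /= subr0 in z2.
    have P0 : 0 <= eta * sqn z `^ (- (1 / 4)) by rewrite mulr_ge0 ?powR_ge0 // ltW.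
    have kz : k < sqn z.
      rewrite ltNge; apply/negP => h; apply: nK; split; first exact: ltW.
      by rewrite (ltW z2).
    have h1 := hk _ kz.
    have h2 : eps * G z <= eps * sqn z `^ (- nu) by rewrite ler_pM2l.
    have := g ord0 z (conj z1 z0); have := g (lift ord0 ord0) z (conj z1 z0).
    rewrite /v /W; lra.
  + move=> z [z1 /andP[z2 _]] nO.
    have z0 : z != 0 by rewrite -sqn_gt0; exact: lt_le_trans z2.
    have P0 : 0 <= eta * sqn z `^ (- (1 / 4)) by rewrite mulr_ge0 ?powR_ge0 // ltW.
    have [zs|zs] := leP (sqn (z - x)) s.
      have E : s = sqn (z - x) by apply/eqP; rewrite eq_le z1 zs.
      by rewrite /v /W !(wdiff_boundary _ E s0) (Gbd z) //; lra.
    have zr : sqn z <= rho.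
      rewrite leNgt; apply/negP => h; apply: nO; split => //.
      by rewrite /= subr0.
    have := hrho z z0 z1 zr.
    have E : sqn z = rho by apply/eqP; rewrite eq_le zr z2.
    have : eps * G z <= 1.
      have : eps * G z <= eps * sqn z `^ (- nu) by rewrite ler_pM2l.
      rewrite E /eps powRN divff //; by rewrite gt_eqF // powR_gt0.
    rewrite /v; lra.
- by split => //=; rewrite subr0.
Qed.

(** Strictness passes from the sum to each component through the coupling. At a zero of w_i, a
    minimum, the Laplacian is -c u_i (|U|^a - |UK|^a), which is negative because the positive sum
    forces |U| > |UK|. *)
Lemma wdiff_gt0 x s i y : good x s -> 0 < s < sqn x -> exterior x s y ->
  0 < u i y -> 0 < wdiff U x s i y.
Proof.
move=> g hs Ey ui; have [y1 y0] := Ey.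
have sq := ltW y1.
rewrite lt_def (g i y Ey) andbT; apply/eqP => w0.
have lap := has_lap_wdiff hn hU i hs sq y0.
have nmin : \forall z \near y, wdiff U x s i y <= wdiff U x s i z.
  have oE : open_nbhs y (exterior x s) by split; [exact: open_ext|].
  by apply: filterS (open_nbhs_nbhs oE) => z Ez; rewrite w0; exact: g.
have := has_lap_min lap nmin.
have -> : UK U x s y ord0 i = u i y.
  by apply/eqP; rewrite eq_sym -subr_eq0 -[_ - _]/(wdiff U x s i y) w0.
rewrite -mulrBl oppr_ge0 leNgt mulr_gt0 ?(coeff_gt0 hn) // mulr_gt0 //.
rewrite subr_gt0; have /andP[a0 _] := exponent_bounds hn (R := R).
apply: (gt0_ltr_powR a0); rewrite ?nnegrE ?enorm_ge0 //.
have cond j : 0 <= UK U x s y ord0 j <= U y ord0 j.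
  rewrite (UK_ge0 hU _ hs sq) /=.
  by have := g j y Ey; rewrite /wdiff subr_ge0.
have := wdiff_sum_gt0 g hs Ey.
have [h _|h W] := ltP 0 (wdiff U x s ord0 y).
  by apply: (enorm_strict_mono cond (j := ord0)); move: h; rewrite subr_gt0.
apply: (enorm_strict_mono cond (j := lift ord0 ord0)).
suff : 0 < wdiff U x s (lift ord0 ord0) y by rewrite subr_gt0.
by move: h W; lra.
Qed.

End Positivity.

(** * Moving the spheres *)

Section SpheresMove.
Context {R : realType} {n : nat} (hn : (3 <= n)%N) {U : 'rV[R]_n -> 'rV[R]_2}
  (hU : nonneg_singular_solution U).
Implicit Types (x y z : 'rV[R]_n) (s : R) (i j : 'I_2).

Local Notation a := (4 / (n%:R - 2) : R).
Local Notation c := (n%:R * (n%:R - 2) / 4 : R).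
Local Notation nu := ((n%:R - 2) / 2 : R).
Local Notation u := (component U).
Local Notation cs := ((n%:R - 5 / 2) / 2 : R).

(** The singular term acts at the origin, the constant keeps the function bounded below, and the
    last term acts near the sphere. Both [start] and [good_open] use this family. *)
Definition supersol x (b d p : R) z : R :=
  sqn z `^ (- (1 / 4)) + (b + d * sqn (z - x) `^ p).

(** Minus the Laplacian of [supersol]. Writing |z|^(-5/2) as the fifth power of w = |z|^(-1/2) turns
    the estimates below into polynomial inequalities in w. *)
Definition supersol_lap x (d p : R) z : R :=
  cs * (sqn z `^ (- (1 / 4))) ^+ 5
  - d * (2 * p * (2 * p - 2 + n%:R) * sqn (z - x) `^ (p - 1)).

Lemma has_lap_supersol x (b d p : R) y : y != 0 -> 0 < sqn (y - x) ->
  has_lap (supersol x b d p) y (- supersol_lap x d p y).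
Proof.
move=> y0 q0; apply: has_lap_eq.
  apply: has_lapD; first exact: has_lap_singular.
  apply: has_lapD; first exact: has_lap_cst.
  by apply: has_lapZ; exact: has_lap_sqn_powR.
rewrite /supersol_lap -powR_mulrn ?powR_ge0 // -powRrM.
have -> : - (1 / 4) * 5%:R = - (1 / 4) - 1 :> R by field.
by ring.
Qed.

Lemma continuous_supersol x (b d p : R) y : y != 0 -> 0 < sqn (y - x) ->
  {for y, continuous (supersol x b d p)}.
Proof.
move=> y0 q0.
apply: (@continuousD R _ _ (fun z => sqn z `^ (- (1 / 4)))).
  exact: continuous_sqn_powR0.
apply: (@continuousD R _ _ (cst b)); first exact: cst_continuous.
apply: (@continuousM R _ (cst d)); first exact: cst_continuous.
exact: continuous_sqn_powR.
Qed.

Lemma cs_ge : 1 / 4 <= cs.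
Proof. by have := dim_ge3 hn (R := R); lra. Qed.

(** Up to z = 1 + 4 C the constant suffices; beyond it z^4 >= z > 4 C and [cs] >= 1/4, so the
    quintic term alone does. *)
Lemma quintic_absorb (C z : R) : 0 <= C -> 0 <= z ->
  C * z <= C * (1 + 4 * C) + cs * z ^+ 5.
Proof.
move=> C0 z0; have c0 := cs_ge.
have z5 : 0 <= z ^+ 5 by rewrite exprn_ge0.
have cz : 0 <= cs * z ^+ 5 by apply: mulr_ge0 => //; lra.
have [zM|zM] := leP z (1 + 4 * C).
  have h : C * z <= C * (1 + 4 * C) by rewrite ler_wpM2l.
  by lra.
have M1 : 0 <= C * (1 + 4 * C) by rewrite mulr_ge0 //; lra.
suff : C * z <= cs * z ^+ 5 by lra.
rewrite (exprS z 4) mulrCA [C * z]mulrC ler_wpM2l //.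
have z4 : z <= z ^+ 4 by apply: ler_eXnr => //; lra.
have : 1 / 4 * z <= cs * z ^+ 4.
  by apply: ler_pM => //; lra.
lra.
Qed.

(** Here w is |z|^(-1/2) and k a power of [kfac] that equals 1 on the sphere; the bound 1/4 keeps z
    away from the sphere. *)
Lemma confine_boundary (C w e k : R) : 0 <= C -> 0 <= w -> 0 <= k ->
  4 * (C * (1 + 4 * C) + 2 * C + 1) <= e ->
  cs * w ^+ 5 + e * k <= C * (w + 2) -> k <= 1 / 4.
Proof.
move=> C0 w0 k0; set D := C * _ + 2 * C + 1 => De L.
have D0 : 0 < D.
  have : 0 <= C * (1 + 4 * C) by rewrite mulr_ge0 //; lra.
  by rewrite /D; lra.
have h1 : e * k <= D by have := quintic_absorb C0 w0; rewrite /D; lra.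
have h2 : D * (4 * k) <= D * 1.
  rewrite mulr1; apply: le_trans h1; rewrite mulrCA mulrA.
  exact: ler_wpM2r.
by move: h2; rewrite ler_pM2l //; lra.
Qed.

(** The quintic beats the linear growth in w, so z stays away from the origin. *)
Lemma confine_origin (C w : R) : 0 <= C -> 0 <= w ->
  cs * w ^+ 5 <= C * (w + 2) -> w <= 1 + 12 * C.
Proof.
move=> C0 w0 L; have c0 := cs_ge.
have [w1|w1] := leP w 1; first by lra.
have w4 : w <= w ^+ 4 by apply: ler_eXnr => //; exact: ltW.
have wp : 0 < w by exact: lt_trans w1.
have p4 : 0 <= w ^+ 4 by exact: exprn_ge0.
have h1 : w * (1 / 4 * w ^+ 4) <= w * (C * 3).
  apply: le_trans (_ : cs * w ^+ 5 <= _).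
    by rewrite (exprS w 4) (mulrCA cs) ler_pM2l // ler_wpM2r.
  apply: le_trans L _; rewrite mulrCA ler_wpM2l //; lra.
by move: h1; rewrite ler_pM2l //; lra.
Qed.

(** With k = [kfac], of order |z|^(-2) = w^4, the right side is of order w^8 against w^5 on the
    left. Hence w is bounded below and z bounded. *)
Lemma confine_infinity (C w k t : R) : 0 <= C -> 0 < w <= 1 -> 0 <= k ->
  k <= 4 * t * w ^+ 4 -> cs * w ^+ 5 <= C * (k ^+ 2 * (w + 2)) ->
  1 <= 12 * (16 * C * t ^+ 2 + 1) * w.
Proof.
move=> C0 /andP[w0 w1] k0 kt L; have c0 := cs_ge.
have w5 : 0 < w ^+ 5 by rewrite exprn_gt0.
have k2 : k ^+ 2 <= 16 * t ^+ 2 * w ^+ 8.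
  have -> : 16 * t ^+ 2 * w ^+ 8 = (4 * t * w ^+ 4) ^+ 2 by ring.
  by rewrite ler_pXn2r // nnegrE // (le_trans k0).
have w86 : w ^+ 8 <= w ^+ 6 by apply: ler_wiXn2l => //; exact: ltW.
have T0 : 0 <= 16 * C * t ^+ 2 by rewrite mulr_ge0 ?sqr_ge0 // mulr_ge0.
have h1 : C * (k ^+ 2 * (w + 2)) <= C * (16 * t ^+ 2 * w ^+ 8 * 3).
  by rewrite ler_wpM2l // ler_pM ?sqr_ge0 //; lra.
have h2 : 16 * C * t ^+ 2 * w ^+ 8 <= 16 * C * t ^+ 2 * w ^+ 6.
  by rewrite ler_wpM2l.
have h3 : cs * w ^+ 5 <= 3 * (16 * C * t ^+ 2 + 1) * w * w ^+ 5.
  have -> : 3 * (16 * C * t ^+ 2 + 1) * w * w ^+ 5 =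
    3 * (16 * C * t ^+ 2 * w ^+ 6) + 3 * w ^+ 6 by ring.
  have w6 : 0 <= w ^+ 6 by rewrite exprn_ge0 // ltW.
  apply: le_trans L _; apply: le_trans h1 _.
  have -> : C * (16 * t ^+ 2 * w ^+ 8 * 3) = 3 * (16 * C * t ^+ 2 * w ^+ 8) by ring.
  by lra.
by move: h3; rewrite ler_pM2r //; lra.
Qed.

(** The last term of the supersolution is t = [kfac]^(1/4) and contributes cs t^5 / s to
    [supersol_lap]. For small s this exceeds what [comparison] allows at every point, so there is no
    negative value at all. *)
Lemma start x : x != 0 -> exists2 s1, 0 < s1 < sqn x &
  forall s, 0 < s < s1 -> good (U := U) x s.
Proof.
move=> x0; have X0 : 0 < sqn x by rewrite sqn_gt0.
have [B B0 hB] := @ball_bound _ _ _ hU x (sqn x / 2)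
  ltac:(by rewrite ltr_pdivrMr // ltr_pMr // ltr1n).
pose C := 9 * c * B `^ a.
have C0 : 0 <= C.
  by rewrite mulr_ge0 ?powR_ge0 // mulr_ge0 // ltW // (coeff_gt0 hn).
pose D := C * (1 + 4 * C) + 2 * C + 1.
have D0 : 0 < D.
  have : 0 <= C * (1 + 4 * C) by rewrite mulr_ge0 //; lra.
  by rewrite /D; lra.
(* The first bound makes B independent of s; the second gives D < cs / s because cs >= 1/4. *)
exists (Num.min (sqn x / 2) (1 / (4 * D))).
  rewrite lt_min gt_min !divr_gt0 ?mulr_gt0 //=.
  by rewrite ltr_pdivrMr // ltr_pMr // ltr1n.
move=> s /andP[s0]; rewrite lt_min => /andP[sx sD] i y Ey.
have hs : 0 < s < sqn x by rewrite s0 (lt_trans sx) // ltr_pdivrMr // ltr_pMr // ltr1n.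
rewrite leNgt; apply/negP => wneg.
have hB' z : sqn (z - x) <= s -> enorm (U z) <= B.
  by move=> h; apply: hB; apply: le_trans h (ltW sx).
have [||j [z [[Ez1 Ez2] _ L]]] := comparison hn hU hs hB'
  (phi := supersol x 1 (s `^ (1 / 4)) (- (1 / 4)))
  (Lphi := supersol_lap x (s `^ (1 / 4)) (- (1 / 4))) _ _ Ey wneg.
- move=> w w0 sw; have q0 := sqn_center_gt0 s0 sw.
  split; first exact: continuous_supersol.
  by rewrite /supersol addrC lerD2l lerDl mulr_ge0 ?powR_ge0.
- by move=> w [w1 w0]; apply: has_lap_supersol => //; apply: lt_trans w1.
have q0 : 0 < sqn (z - x) by exact: lt_trans Ez1.
pose t := kfac x s z `^ (1 / 4).
have /andP[k0 k1] := kfac_bounds s0 (ltW Ez1).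
have t0 : 0 < t by rewrite powR_gt0.
have t1 : t <= 1.
  have E1 : (1 : R) `^ (1 / 4) = 1 by rewrite powR1.
  have f0 : 0 <= 1 / 4 :> R by rewrite divr_ge0.
  by rewrite -[leRHS]E1; apply: (ge0_ler_powR f0) k1; rewrite nnegrE // ltW.
have tE : s `^ (1 / 4) * sqn (z - x) `^ (- (1 / 4)) = t.
  rewrite /t /kfac powRM ?invr_ge0 ?(ltW q0) ?(ltW s0) //; congr (_ * _).
  by rewrite -[(sqn _)^-1]powR_inv1 ?ltW // -powRrM mulN1r.
have kE : kfac x s z = t ^+ 4.
  rewrite -powR_mulrn ?(ltW t0) // -powRrM (_ : 1 / 4 * 4%:R = 1) ?powRr1 ?ltW //.
  by field.
have t5 : s `^ (1 / 4) * sqn (z - x) `^ (- (1 / 4) - 1) = t ^+ 5 / s.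
  rewrite powRB; last by rewrite (gt_eqF q0) implybT.
  rewrite powRr1 ?(ltW q0) // mulrA tE (exprSr t 4) -kE /kfac.
  by field; rewrite !gt_eqF.
move: L; rewrite /supersol_lap /supersol -/C tE kE.
have -> : s `^ (1 / 4) * (2 * - (1 / 4) * (2 * - (1 / 4) - 2 + n%:R) *
    sqn (z - x) `^ (- (1 / 4) - 1)) = - cs * (t ^+ 5 / s).
  by rewrite -t5; field.
set w := sqn z `^ _; have w0 : 0 <= w by exact: powR_ge0.
apply/negP; rewrite -ltNge.
have t85 : (t ^+ 4) ^+ 2 <= t ^+ 5.
  by rewrite -exprM; apply: ler_wiXn2l => //; exact: ltW.
have t51 : t ^+ 5 <= 1 by rewrite exprn_ile1 // ltW.
have tp5 : 0 < t ^+ 5 by rewrite exprn_gt0.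
have cw : 0 <= cs * w ^+ 5 by have c0 := cs_ge; rewrite mulr_ge0 ?exprn_ge0 //; lra.
have qa := quintic_absorb C0 w0.
(* Since t <= 1, the factor t^8 is at most t^5. The part linear in w goes into the quintic, the rest
   into t^5 D. *)
have h1 : C * ((t ^+ 4) ^+ 2 * (w + (1 + t))) <=
    t ^+ 5 * (C * (1 + 4 * C) + 2 * C) + cs * w ^+ 5.
  apply: le_trans (_ : t ^+ 5 * (C * w + 2 * C) <= _).
    rewrite mulrCA; apply: ler_pM => //; first by rewrite exprn_ge0 // exprn_ge0 // ltW.
      by rewrite mulr_ge0 // addr_ge0 //; lra.
    by rewrite mulrDr lerD2l [2 * C]mulrC ler_wpM2l //; lra.
  apply: le_trans (_ : t ^+ 5 * (C * (1 + 4 * C) + cs * w ^+ 5 + 2 * C) <= _).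
    by rewrite ler_wpM2l ?(ltW tp5) //; lra.
  have : t ^+ 5 * (cs * w ^+ 5) <= cs * w ^+ 5 by rewrite ler_piMl.
  lra.
have h2 : t ^+ 5 * D < cs * (t ^+ 5 / s).
  have -> : cs * (t ^+ 5 / s) = t ^+ 5 * (cs / s) by field; rewrite gt_eqF.
  rewrite ltr_pM2l // ltr_pdivlMr //.
  have : s * (4 * D) < 1 by rewrite -ltr_pdivlMr // mulr_gt0.
  by have := cs_ge; lra.
have : t ^+ 5 * D = t ^+ 5 * (C * (1 + 4 * C) + 2 * C) + t ^+ 5 by rewrite /D; ring.
lra.
Qed.

Lemma continuous_wdiff_pair x s i y : 0 < s < sqn x -> s <= sqn (y - x) ->
  y != 0 ->
  {for (y, s), continuous (fun p : 'rV[R]_n * R => wdiff U x p.2 i p.1)}.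
Proof.
move=> hs sq y0; have /andP[s0 sx] := hs.
have q0 := sqn_center_gt0 s0 sq.
pose P := ('rV[R]_n * R)%type.
have cf : {for (y, s), continuous (fst : P -> _)} by exact: cvg_fst.
have ck : {for (y, s), continuous (fun p : P => kfac x p.2 p.1)}.
  apply: (@continuousM R _ (snd : P -> R) (fun p => (sqn (p.1 - x))^-1)).
    exact: cvg_snd.
  apply: (@continuousV R _ (fun p : P => sqn (p.1 - x))).
    by rewrite gt_eqF.
  apply: (@continuous_comp _ _ _ (fst : P -> _) (fun z => sqn (z - x))) => //.
  exact: continuous_sqnB.
have ci : {for (y, s), continuous (fun p : P => inversion x p.2 p.1)}.
  apply: (@continuousD R _ _ (cst x)); first exact: cst_continuous.
  apply: (@continuousZ R _ _ (fun p : P => kfac x p.2 p.1) (fun p => p.1 - x)) => //.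
  by apply: (@continuousB R _ _ (fst : P -> _) (cst x)) => //; exact: cst_continuous.
have -> : (fun p : P => wdiff U x p.2 i p.1) = (fun p => u i p.1 -
    kfac x p.2 p.1 `^ nu * u i (inversion x p.2 p.1)).
  by apply/funext => p; rewrite /wdiff UKE.
apply: (@continuousB R _ _ (fun p : P => u i p.1)).
  by apply: (@continuous_comp _ _ _ (fst : P -> _) (u i)) => //; exact: continuous_u.
apply: (@continuousM R _ (fun p : P => kfac x p.2 p.1 `^ nu)).
  apply: (@continuous_comp _ _ _ (fun p : P => kfac x p.2 p.1) (fun t : R => t `^ nu)) => //.
  by apply: continuous_powR; rewrite divr_gt0.
apply: (@continuous_comp _ _ _ (fun p : P => inversion x p.2 p.1) (u i)) => //.
by apply: (continuous_u hU); exact: inversion_neq0.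
Qed.

Lemma near_gt (T : topologicalType) (f : T -> R) (p : T) (b : R) :
  {for p, continuous f} -> b < f p -> \forall q \near p, b < f q.
Proof. by move=> cf; exact: (cvgr_gt _ cf). Qed.

Lemma near_lt (T : topologicalType) (f : T -> R) (p : T) (b : R) :
  {for p, continuous f} -> f p < b -> \forall q \near p, f q < b.
Proof. by move=> cf; exact: (cvgr_lt _ cf). Qed.

Lemma near_forall_imp (T : topologicalType) (I : finType) (p : T)
    (A : I -> Prop) (P : I -> T -> Prop) :
  (forall k : I, A k -> \forall q \near p, P k q) ->
  \forall q \near p, forall k : I, A k -> P k q.
Proof.
move=> h; apply: filter_forall => k.
have [HA|nA] := pselect (A k); last by apply: nearW => q /nA.
by apply: filterS (h k HA).
Qed.

(** The tube lemma, which is why the difference is needed as a jointly continuous function of y and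
    s. *)
Lemma wdiff_near x s i (K : set 'rV[R]_n) : compact K -> 0 < s < sqn x ->
  (forall y, K y -> [/\ s <= sqn (y - x), y != 0 & 0 < wdiff U x s i y]) ->
  \forall r \near s, forall y, K y -> 0 < wdiff U x r i y.
Proof.
move=> /compact_near_coveringP cK hs hK.
have := cK R (nbhs s) (fun r y => 0 < wdiff U x r i y) _; apply => y Ky.
have [sq y0 w0] := hK y Ky.
exact: (near_gt (f := fun p : 'rV[R]_n * R => wdiff U x p.2 i p.1)
  (@continuous_wdiff_pair x s i y hs sq y0) w0).
Qed.

(* Bad points for [s] slightly larger than [s0] are confined by [comparison] to
   a fixed compact subset of the exterior for [s0], where the differences are
   bounded below. *)
Lemma good_open x s0 : 0 < s0 < sqn x -> good (U := U) x s0 ->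
  \forall s \near s0, s0 <= s -> good (U := U) x s.
Proof.
move=> hs0 g0; have /andP[s00 s0x] := hs0.
have X0 : 0 < sqn x by exact: lt_trans s0x.
(* An upper limit for s, strictly below |x|^2, that makes B uniform in s. *)
pose s2 := (s0 + sqn x) / 2.
have s02 : s0 < s2 by rewrite /s2; lra.
have s2x : s2 < sqn x by rewrite /s2; lra.
have s20 : 0 < s2 by lra.
have [B B0 hB] := ball_bound hU s2x.
pose C := 9 * c * B `^ a.
have C0 : 0 <= C.
  by rewrite mulr_ge0 ?powR_ge0 // mulr_ge0 // ltW // (coeff_gt0 hn).
pose D := C * (1 + 4 * C) + 2 * C + 1.
have CC0 : 0 <= C * (1 + 4 * C) by rewrite mulr_ge0 //; lra.
have D0 : 0 < D by rewrite /D; lra.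
pose T := 4 * s0 * D; have T0 : 0 < T by rewrite !mulr_gt0.
have n3 := dim_ge3 hn (R := R).
pose p : R := n%:R + T.
pose E := 2 * p * (2 * p + 2 - n%:R).
have ET : T <= E.
  rewrite -[T]mul1r /E; apply: ler_pM; rewrite /p; lra.
(* Then phi = |z|^(-1/2) + 2 - (s0 / |z - x|^2)^p. It does not depend on s, and its large concave
   bend at the sphere repels minimum points from there. *)
pose d := - s0 `^ p.
pose phi := supersol x 2 d (- p).
(* The bound 1/4 on [kfac]^(p+1) means [kfac] <= th, that is |z - x|^2 >= s' with s' > s0. *)
pose th : R := (1 / 4) `^ (p + 1)^-1.
have p1 : 0 < p + 1 by rewrite /p; lra.
have th0 : 0 < th by rewrite powR_gt0 // divr_gt0.
have th1 : th < 1.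
  have E1 : (1 : R) `^ (p + 1)^-1 = 1 by rewrite powR1.
  have ip : 0 < (p + 1)^-1 by rewrite invr_gt0.
  rewrite -[ltRHS]E1 /th; apply: (gt0_ltr_powR ip); rewrite ?nnegrE; lra.
pose s' := s0 / th.
have s's : s0 < s' by rewrite ltr_pdivlMr // gtr_pMr.
(* Inside |z|^2 <= rho the value of w is at least 2 + 12 C, above the limit 1 + 12 C of
   [confine_origin]. *)
have [rho rho0 hrho] := @powRN_blowup _ (2 + 12 * C) 1 ltac:(lra) ltr01.
pose C' := 16 * C * s2 ^+ 2 + 1.
have C'0 : 0 < C' by rewrite ltr_wpDl // mulr_ge0 ?sqr_ge0 // mulr_ge0.
have [k kp hk] := @powRN_decay R (1 / 4) (12 * C') 1 ltac:(lra) ltac:(lra) ltr01.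
(* Beyond rr one has w <= 1, |z|^2 <= 4 |z - x|^2 and a contradiction with [confine_infinity]. *)
pose rr := k + 4 * sqn x + 1.
pose K := [set y | s' <= sqn (y - x) /\ rho <= sqn y <= rr].
have Kin y : K y -> exterior x s0 y.
  move=> [y1 /andP[y2 _]]; split; first exact: lt_le_trans y1.
  by rewrite -sqn_gt0; exact: lt_le_trans y2.
suff bad s i y : s0 <= s -> s < s2 -> exterior x s y -> wdiff U x s i y < 0 ->
    exists j z, [/\ K z, exterior x s z & wdiff U x s j z < 0].
  have near_all : \forall s \near s0, forall j,
      (forall z, z != 0 -> 0 < u j z) -> forall y, K y -> 0 < wdiff U x s j y.
    apply: (near_forall_imp (P := fun j r => forall y, K y -> 0 < wdiff U x r j y)).
    move=> j up; apply: (wdiff_near (@compact_shell _ _ x s' rho rr) hs0) => y Ky.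
    have [y1 y0] := Kin y Ky.
    by split; [exact: ltW|exact: y0|apply: wdiff_gt0 => //; exact: up].
  near=> s => ss i y Ey; rewrite leNgt; apply/negP => wneg.
  have ls2 : s < s2 by near: s; exact: lt_nbhsl.
  have hj : forall j, (forall z, z != 0 -> 0 < u j z) -> forall y, K y ->
    0 < wdiff U x s j y by near: s.
  have [j [z [Kz Ez wz]]] := bad s i y ss ls2 Ey wneg.
  (* A vanishing component has zero difference and cannot be negative, so strict positivity at s0 is
     only used for positive components. *)
  have [uz|up] := u_zero_or_pos hn hU j.
    have hs : 0 < s < sqn x by rewrite (lt_le_trans s00 ss) (lt_trans ls2).
    have [Ez1 z0] := Ez.
    move: wz; rewrite /wdiff UKE /kelvin !uz ?mulr0 ?subrr ?ltxx //.
    exact: (inversion_neq0 hs (ltW Ez1)).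
  by have := hj j up z Kz; rewrite ltNge (ltW wz).
move=> ss ls2 Ey wneg.
have s0' : 0 < s by exact: lt_le_trans ss.
have hs : 0 < s < sqn x by rewrite s0' (lt_trans ls2).
have hB' z : sqn (z - x) <= s -> enorm (U z) <= B.
  by move=> h; apply: hB; apply: le_trans h (ltW ls2).
have dE z : 0 < sqn (z - x) ->
    d * sqn (z - x) `^ (- p) = - kfac x s0 z `^ p.
  move=> q0; rewrite /kfac powRM ?invr_ge0 ?(ltW q0) ?(ltW s00) // mulNr.
  by rewrite -[(sqn _)^-1]powR_inv1 ?ltW // -powRrM mulN1r.
have [||j [z [[Ez1 Ez2] wz L]]] := comparison hn hU hs hB'
  (phi := phi) (Lphi := supersol_lap x d (- p)) _ _ Ey wneg.
- move=> w w0 sw; have q0 := sqn_center_gt0 s0' sw.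
  split; first exact: continuous_supersol.
  rewrite /phi /supersol addrC lerD2l dE //.
  have /andP[k0 k1] := kfac_bounds s00 (le_trans ss sw).
  suff : kfac x s0 w `^ p <= 1 by lra.
  have E1 : (1 : R) `^ p = 1 by rewrite powR1.
  have p0 : 0 <= p by rewrite /p; lra.
  by rewrite -[leRHS]E1; apply: (ge0_ler_powR p0) k1; rewrite nnegrE // ltW.
- by move=> w [w1 w0]; apply: has_lap_supersol => //; apply: lt_trans w1.
exists j, z; split => //.
have q0 : 0 < sqn (z - x) by exact: lt_trans Ez1.
have /andP[k0 k1] := kfac_bounds s0' (ltW Ez1).
have dLE : d * (2 * - p * (2 * - p - 2 + n%:R) * sqn (z - x) `^ (- p - 1)) =
    - (E / s0 * kfac x s0 z `^ (p + 1)).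
  have -> : kfac x s0 z `^ (p + 1) = s0 * s0 `^ p * sqn (z - x) `^ (- p - 1).
    rewrite /kfac powRM ?invr_ge0 ?(ltW q0) ?(ltW s00) // powRS //.
    rewrite -[(sqn _)^-1]powR_inv1 ?ltW // -powRrM mulN1r.
    by congr (_ * _ `^ _); ring.
  by rewrite /d /E; field; rewrite gt_eqF.
move: L; rewrite /supersol_lap dLE opprK -/C.
set w := sqn z `^ (- (1 / 4)); have w0 : 0 <= w by exact: powR_ge0.
have phile : phi z <= w + 2.
  rewrite /phi /supersol -/w lerD2l dE //.
  by have := powR_ge0 (kfac x s0 z) p; lra.
set kp1 := kfac x s0 z `^ (p + 1); have kp0 : 0 <= kp1 by exact: powR_ge0.
have E0 : 0 < E by exact: lt_le_trans ET.
have Es0 : 0 <= E / s0 * kp1 by rewrite mulr_ge0 // divr_ge0 // ltW.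
have k21 : kfac x s z ^+ 2 <= 1 by rewrite exprn_ile1 // ltW.
have k20 : 0 <= kfac x s z ^+ 2 by rewrite exprn_ge0 // ltW.
have cw : 0 <= cs * w ^+ 5.
  by rewrite mulr_ge0 ?exprn_ge0 // (le_trans _ cs_ge) // divr_ge0.
move=> L; have {}L : cs * w ^+ 5 + E / s0 * kp1 <= C * (kfac x s z ^+ 2 * (w + 2)).
  by apply: le_trans L _; rewrite ler_wpM2l // ler_wpM2l.
have L1 : cs * w ^+ 5 + E / s0 * kp1 <= C * (w + 2).
  by apply: le_trans L _; rewrite ler_wpM2l // ler_piMl // addr_ge0.
have L2 : cs * w ^+ 5 <= C * (kfac x s z ^+ 2 * (w + 2)).
  by apply: le_trans L; rewrite lerDl.
have L3 : cs * w ^+ 5 <= C * (w + 2) by apply: le_trans L1; rewrite lerDl.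
split.
- have h1 : 4 * D <= E / s0.
    by rewrite ler_pdivlMr // (le_trans _ ET) // /T mulrAC.
  have h3 : kp1 <= 1 / 4 := confine_boundary C0 w0 kp0 h1 L1.
  have kt : kfac x s0 z <= th.
    have k00 : 0 <= kfac x s0 z by rewrite divr_ge0 // ltW.
    have -> : kfac x s0 z = kp1 `^ (p + 1)^-1.
      by rewrite /kp1 -powRrM mulfV ?powRr1 // gt_eqF.
    have ip : 0 <= (p + 1)^-1 by rewrite invr_ge0 ltW.
    by apply: (ge0_ler_powR ip) h3; rewrite ?nnegrE // divr_ge0.
  by move: kt; rewrite /kfac /s' !ler_pdivrMr // mulrC.
- have qz : 0 < sqn z by rewrite sqn_gt0.
  have wle : w <= 1 + 12 * C := confine_origin C0 w0 L3.
  apply/andP; split; rewrite leNgt; apply/negP => h.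
    have := hrho (sqn z); rewrite qz (ltW h) => /(_ isT); rewrite mul1r -/w.
    by move=> /le_trans /(_ wle); rewrite lerD2r (ler_nat _ 2 1).
  have zk : k < sqn z.
    by apply: lt_trans h; rewrite /rr -addrA ltrDl addr_gt0 // mulr_gt0.
  have := hk _ zk; rewrite -/w ltNge => /negP; apply.
  have wp : 0 < w by rewrite powR_gt0.
  have z1 : 1 <= sqn z.
    by apply: le_trans (ltW h); rewrite /rr lerDr addr_ge0 ?mulr_ge0 // ltW.
  have w1 : w <= 1.
    have E1 : (1 : R) `^ (1 / 4) = 1 by rewrite powR1.
    have f0 : 0 <= 1 / 4 :> R by rewrite divr_ge0.
    have h1 : 1 <= sqn z `^ (1 / 4).
      by rewrite -[leLHS]E1; apply: (ge0_ler_powR f0); rewrite ?nnegrE ?(ltW qz).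
    by rewrite /w powRN invf_le1 // (lt_le_trans ltr01).
  apply: (confine_infinity C0 _ (ltW k0) _ L2); first by rewrite wp.
  have -> : w ^+ 4 = (sqn z)^-1.
    rewrite -[RHS]powR_inv1 ?(ltW qz) // -powR_mulrn // /w -powRrM.
    by congr (_ `^ _); field.
  rewrite ler_pdivrMr // mulrAC ler_pdivlMr //.
  have h4 : sqn z <= 4 * sqn (z - x).
    have := sqnD_le (z - x) x; rewrite subrK.
    clear -h kp X0; move: h; rewrite /rr; lra.
  have -> : 4 * s2 * sqn (z - x) = s2 * (4 * sqn (z - x)) by ring.
  by apply: ler_pM => //; exact: ltW.
Unshelve. all: by end_near.
Qed.

(** Continuity method: the infimum b of the bad values is positive by [start], good by passage to
    the limit, and then contradicts [good_open]. *)
Lemma all_good x s : 0 < s < sqn x -> good (U := U) x s.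
Proof.
move=> /andP[s0 sx]; apply: contrapT => nbad.
have X0 : 0 < sqn x by exact: lt_trans sx.
have x0 : x != 0 by rewrite -sqn_gt0.
have [s1 /andP[s10 s1x] hs1] := start x0.
pose B := [set r | 0 < r < sqn x /\ ~ good (U := U) x r].
have Bs : B s by split; [rewrite s0|].
have lB r : B r -> s1 <= r.
  move=> [/andP[r0 rx] ng]; rewrite leNgt; apply/negP => rs1; apply: ng.
  by apply: hs1; rewrite r0.
have iB : has_inf B by split; [exists s|exists s1 => r /lB].
pose b := inf B.
have b1 : s1 <= b by apply: lb_le_inf; [exists s|move=> r /lB].
have bs : b <= s by apply: ge_inf => //; exists s1 => r /lB.
have hb : 0 < b < sqn x by rewrite (lt_le_trans s10 b1) (le_lt_trans bs).
have below r : 0 < r < b -> good (U := U) x r.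
  move=> /andP[r0 rb]; apply: contrapT => ng.
  have : b <= r.
    apply: ge_inf; first by exists s1 => t /lB.
    by split => //; rewrite r0 (lt_trans rb) //; case/andP: hb.
  by rewrite leNgt rb.
(* A negative value at b would persist at the same y for slightly smaller r, whose exterior is
   larger. *)
have gb : good (U := U) x b.
  move=> i y [y1 y0]; rewrite leNgt; apply/negP => wneg.
  have cw := @continuous_wdiff_pair x b i y hb (ltW y1) y0.
  have nb : nbhs (y, b) (fun p : 'rV[R]_n * R => wdiff U x p.2 i p.1 < 0).
    exact: (near_lt cw).
  have [[A1 A2] [/= nA1 nA2] sub] := nb.
  have [e /= e0 he] := nA2.
  have b0 : 0 < b by case/andP: hb.
  pose r := Num.max (b / 2) (b - e / 2).
  have rb : r < b by rewrite gt_max; apply/andP; split; lra.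
  have r0 : 0 < r by rewrite lt_max; apply/orP; left; lra.
  have rle : b - e / 2 <= r by rewrite le_max lexx orbT.
  have : wdiff U x r i y < 0.
    apply: (sub (y, r)); split; first exact: nbhs_singleton.
    by apply: he; rewrite /ball_ /= ltr_norml; apply/andP; split; lra.
  rewrite ltNge => /negP; apply; apply: below; first by rewrite r0.
  by split => //; exact: lt_trans y1.
have [e /= e0 he] := good_open hb gb.
have [r Br rb] := inf_adherent e0 iB.
have br : b <= r by apply: ge_inf => //; exists s1 => t /lB.
apply: Br.2; apply: he => //.
rewrite /ball_ /= ltr_norml; apply/andP; split; rewrite -/b in rb; lra.
Qed.

End SpheresMove.

(** * Radial symmetry *)

Section Radial.
Context {R : realType} {n : nat} (hn : (3 <= n)%N) {U : 'rV[R]_n -> 'rV[R]_2}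
  (hU : nonneg_singular_solution U).
Implicit Types (x y z : 'rV[R]_n) (s : R) (i j : 'I_2).

Local Notation nu := ((n%:R - 2) / 2 : R).
Local Notation u := (component U).

(* The inversion exchanging [y] and [z] is centred on the line through them, and
   the power of the centre with respect to the sphere [|.| = |y|] shows that the
   radius is admissible. *)
Lemma reflection_le i y z (th : R) : y != 0 -> y != z -> sqn y = sqn z ->
  0 < th < 1 -> th `^ nu * u i z <= u i y.
Proof.
move=> y0 yz E /andP[th0 th1].
have d0 : 0 < sqn (y - z) by rewrite sqn_gt0 subr_eq0.
(* This position of the centre makes [kfac] at y equal to th; letting th tend to 1 sends the centre
   to infinity. *)
pose t := th / (1 - th); have t0 : 0 < t by rewrite divr_gt0 // subr_gt0.
pose x := z + t *: (z - y).
pose s := t * (1 + t) * sqn (y - z).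
have tt0 : 0 < 1 + t by rewrite addr_gt0.
have s0 : 0 < s by apply: mulr_gt0 => //; exact: mulr_gt0.
have yx : y - x = (1 + t) *: (y - z).
  by apply/rowP => k; rewrite !mxE; ring.
have qE : sqn (y - x) = (1 + t) ^+ 2 * sqn (y - z).
  by rewrite yx sqnE dotZl dotZr -sqnE mulrA -expr2.
have sx : s < sqn x.
  have -> : sqn x = s + sqn y.
    rewrite /s sqnB -E (sqnE x) /x !dotE -!sqnE -E (dotC z y) /t.
    by field; rewrite subr_eq0 gt_eqF.
  by rewrite ltrDl sqn_gt0.
have Ey : exterior x s y.
  split => //; rewrite qE /s ltr_pM2r // expr2 ltr_pM2r //.
  by rewrite ltrDr.
have := all_good hn hU (x := x) (s := s) ltac:(by rewrite s0) i Ey.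
rewrite /wdiff subr_ge0 UKE /kelvin.
have tth : t = th * (1 + t).
  by rewrite /t; field; rewrite subr_eq0 gt_eqF.
have kE : kfac x s y = th.
  rewrite /kfac qE /s {1}tth; field.
  by rewrite (gt_eqF tt0) (gt_eqF d0).
have -> : inversion x s y = z.
  rewrite /inversion kE yx scalerA -tth /x -addrA -scalerDr.
  by rewrite -opprB addNr scaler0 addr0.
by rewrite kE.
Qed.

(** Instead of a limit, one value of th is used: if u_i(y) < u_i(z), choose it so that th^nu u_i(z)
    is the mean of the two values, which exceeds u_i(y). *)
Lemma radial_le i y z : y != 0 -> sqn y = sqn z -> u i z <= u i y.
Proof.
move=> y0 E; have [->//|yz] := eqVneq y z.
rewrite leNgt; apply/negP => lt.
have uy := u_ge0 hU i y0.
have uz : 0 < u i z by exact: le_lt_trans lt.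
pose q := (1 + u i y / u i z) / 2.
have r1 : u i y / u i z < 1 by rewrite ltr_pdivrMr // mul1r.
have r0 : 0 <= u i y / u i z by rewrite divr_ge0 // ltW.
have q0 : 0 < q by rewrite /q; lra.
have q1 : q < 1 by rewrite /q; lra.
have nu0 := nu_gt0 hn (R := R).
have th : 0 < q `^ nu^-1 < 1.
  rewrite powR_gt0 //=.
  have E1 : (1 : R) `^ nu^-1 = 1 by rewrite powR1.
  have ip : 0 < nu^-1 by rewrite invr_gt0.
  by rewrite -[ltRHS]E1; apply: (gt0_ltr_powR ip); rewrite ?nnegrE // ltW.
have := reflection_le i y0 yz E th.
rewrite -powRrM mulVf ?gt_eqF // powRr1 ?(ltW q0) //.
have -> : q * u i z = (u i z + u i y) / 2 by rewrite /q; field; rewrite gt_eqF.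
by lra.
Qed.

Lemma u_radial i y z : y != 0 -> sqn y = sqn z -> u i y = u i z.
Proof.
move=> y0 E; have z0 : z != 0 by rewrite -sqn_gt0 -E sqn_gt0.
by apply/eqP; rewrite eq_le !radial_le.
Qed.

End Radial.

(** * The radial system *)

Section RadialSystem.
Context {R : realType}.
Implicit Types (f g F dF : R -> R) (r : R).

Lemma monotone_pos F dF : (forall r, 0 < r -> is_derive r 1 F (dF r)) ->
  (forall r, 0 < r -> 0 <= dF r) ->
  forall r1 r2, 0 < r1 -> r1 <= r2 -> F r1 <= F r2.
Proof.
move=> hF dF0 r1 r2 r10 r12.
have pos r : r1 <= r -> 0 < r by exact: lt_le_trans.
have [r|r|r rI E] := @MVT_segment R F dF r1 r2 r12.
- by rewrite in_itv /= => /andP[/ltW /pos /hF].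
- apply: derivable_within_continuous => t.
  by rewrite in_itv /= => /andP[/pos /hF []].
move: rI; rewrite in_itv /= => /andP[/pos r0 _].
by rewrite -subr_ge0 E mulr_ge0 ?subr_ge0 // dF0.
Qed.

Lemma constant_pos F : (forall r, 0 < r -> is_derive r 1 F 0) ->
  forall r1 r2, 0 < r1 -> 0 < r2 -> F r1 = F r2.
Proof.
move=> hF; suff le r1 r2 : 0 < r1 -> r1 <= r2 -> F r1 = F r2.
  by move=> r1 r2 r10 r20; have [h|/ltW h] := leP r1 r2; [|symmetry]; exact: le.
move=> r10 r12; apply/eqP; rewrite eq_le.
rewrite (monotone_pos hF) //=.
have hN (r : R) : 0 < r -> is_derive r 1 (fun t => - F t) 0.
  move=> r0; rewrite -[0]oppr0; have h := hF r r0; exact: is_deriveN.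
by rewrite -lerN2; apply: (monotone_pos hN).
Qed.

Variables (nn : R) (f g f1 g1 : R -> R).
Hypothesis nn3 : 3 <= nn.
Hypothesis f0 : forall r, 0 < r -> 0 < f r.
Hypothesis g0 : forall r, 0 < r -> 0 < g r.
Local Notation c := (nn * (nn - 2) / 4).
(** [N] is |U|^2, [E] is the coupling |U|^(4/(n-2)), and [f2], [g2] are the second derivatives
    prescribed by the radial system. *)
Let N r := f r * f r + g r * g r.
Let E r := N r `^ (2 / (nn - 2)).
Let f2 r := - ((nn - 1) / r * f1 r) - c * E r * f r.
Let g2 r := - ((nn - 1) / r * g1 r) - c * E r * g r.
Hypothesis df : forall r, 0 < r -> is_derive r 1 f (f1 r).
Hypothesis dg : forall r, 0 < r -> is_derive r 1 g (g1 r).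
Hypothesis df1 : forall r, 0 < r -> is_derive r 1 f1 (f2 r).
Hypothesis dg1 : forall r, 0 < r -> is_derive r 1 g1 (g2 r).

Let n2_gt0 : 0 < nn - 2.
Proof. by rewrite subr_gt0 (lt_le_trans _ nn3) // ltr_nat. Qed.

Let N0 r : 0 < r -> 0 < N r.
Proof. by move=> r0; rewrite addr_gt0 // mulr_gt0 ?f0 ?g0. Qed.

Let Q r := r `^ (nn - 2).

Definition wronskian r := r `^ (nn - 1) * (f r * g1 r - g r * f1 r).

Lemma wronskian_constant r : 0 < r -> is_derive r 1 wronskian 0.
Proof.
move=> r0; have rn0 : r != 0 by rewrite gt_eqF.
have P1 : r `^ (nn - 1) = r * Q r.
  by rewrite (_ : nn - 1 = nn - 2 + 1); [exact: powRS|ring].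
apply: is_derive_eq.
  exact: (is_deriveMf (is_derive1_powR (nn - 1) r0)
    (is_deriveBf (is_deriveMf (df r0) (dg1 r0)) (is_deriveMf (dg r0) (df1 r0)))).
rewrite /= P1 (_ : nn - 1 - 1 = nn - 2); last by ring.
by rewrite -/(Q r) /f2 /g2; field.
Qed.

(** In the variable t = ln r this is the Hamiltonian of v = r^((n-2)/2) U: half of |v'|^2, plus
    (n-2)^2/8 times |v|^(2n/(n-2)) - |v|^2. *)
Definition pohozaev r :=
  r `^ nn * ((f1 r * f1 r + g1 r * g1 r) / 2 + (nn - 2) ^+ 2 / 8 * (N r * E r))
  + (nn - 2) / 2 * (r `^ (nn - 1) * (f r * f1 r + g r * g1 r)).

Lemma pohozaev_constant r : 0 < r -> is_derive r 1 pohozaev 0.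
Proof.
move=> r0; have rn0 : r != 0 by rewrite gt_eqF.
have P1 : r `^ (nn - 1) = r * Q r.
  by rewrite (_ : nn - 1 = nn - 2 + 1); [exact: powRS|ring].
have P0 : r `^ nn = r * (r * Q r).
  by rewrite -P1 -[X in _ `^ X](subrK 1); exact: powRS.
have n20 : nn - 2 != 0 by rewrite gt_eqF // n2_gt0.
have dN := is_deriveDf (is_deriveMf (df r0) (df r0)) (is_deriveMf (dg r0) (dg r0)).
have dE := is_derive_comp1 dN (is_derive1_powR (2 / (nn - 2)) (N0 r0)).
have ES : E r = N r * N r `^ (2 / (nn - 2) - 1).
  by rewrite /E -[X in _ `^ X](subrK 1); exact: powRS (N0 r0).
apply: is_derive_eq.
  have dD := is_deriveDf (is_deriveMf (df1 r0) (df1 r0))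
    (is_deriveMf (dg1 r0) (dg1 r0)).
  have dD2 := is_deriveMf dD (is_derive_cst (2^-1 : R) r 1).
  have dNE := is_deriveZf ((nn - 2) ^+ 2 / 8) (is_deriveMf dN dE).
  have dS := is_deriveDf (is_deriveMf (df r0) (df1 r0)) (is_deriveMf (dg r0) (dg1 r0)).
  have d1 := is_deriveMf (is_derive1_powR nn r0) (is_deriveDf dD2 dNE).
  have d2 := is_deriveZf ((nn - 2) / 2) (is_deriveMf (is_derive1_powR (nn - 1) r0) dS).
  exact: (is_deriveDf d1 d2).
rewrite /= P0 P1 (_ : nn - 1 - 1 = nn - 2); last by ring.
rewrite -/(Q r) -/(E r) /f2 /g2 -/(N r).
move: ES; rewrite /N; set e := _ `^ (2 / (nn - 2) - 1) => ->.
by field; rewrite n20 rn0.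
Qed.

(** Dropping the kinetic square from the conserved energy leaves k (m^(1 + 2/(n-2)) - m) <= P with m
    = r^(n-2) |U|^2. As soon as m^(2/(n-2)) > 2 this gives k m <= P; [b] is the value of m where
    that power equals 2. *)
Lemma scaled_mass_bounded :
  exists2 M, 0 < M & forall r, 0 < r -> Q r * N r <= M.
Proof.
have n2 := n2_gt0.
have tau0 : 0 < 2 / (nn - 2) by rewrite divr_gt0.
pose k := (nn - 2) ^+ 2 / 8; have k0 : 0 < k by rewrite divr_gt0 // exprn_gt0.
pose b := 2 `^ (2 / (nn - 2))^-1; have b0 : 0 < b by rewrite powR_gt0.
exists (b + `|pohozaev 1 / k|); first by rewrite ltr_wpDr.
move=> r r0; have rn0 : r != 0 by rewrite gt_eqF.
have PE : pohozaev r = pohozaev 1 by exact: (constant_pos pohozaev_constant).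
set m := Q r * N r; have Q0 : 0 < Q r by rewrite powR_gt0.
have m0 : 0 < m by rewrite mulr_gt0 // N0.
have [mb|bm] := leP m b; first by rewrite (le_trans mb) // lerDl.
have P1 : r `^ (nn - 1) = r * Q r.
  by rewrite (_ : nn - 1 = nn - 2 + 1); [exact: powRS|ring].
have P0 : r `^ nn = r * (r * Q r).
  by rewrite -P1 -[X in _ `^ X](subrK 1); exact: powRS.
have mE : m `^ (2 / (nn - 2)) = r ^+ 2 * E r.
  rewrite /m powRM ?ltW ?N0 // -/(E r) /Q -powRrM mulrCA divff ?gt_eqF // mulr1.
  by rewrite powR_mulrn // ltW.
have m2 : 2 < m `^ (2 / (nn - 2)).
  have bE : b `^ (2 / (nn - 2)) = 2.
    by rewrite /b -powRrM mulVf ?powRr1 // gt_eqF.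
  by rewrite -[ltLHS]bE; apply: (gt0_ltr_powR tau0); rewrite ?nnegrE // ltW.
have key : k * (m * m `^ (2 / (nn - 2))) <= pohozaev 1 + k * m.
  rewrite -PE mE /pohozaev P0 P1 /m /k -subr_ge0.
  have -> : r * (r * Q r) * ((f1 r * f1 r + g1 r * g1 r) / 2 + (nn - 2) ^+ 2 / 8 * (N r * E r)) +
    (nn - 2) / 2 * (r * Q r * (f r * f1 r + g r * g1 r)) + (nn - 2) ^+ 2 / 8 * (Q r * N r) -
    (nn - 2) ^+ 2 / 8 * (Q r * N r * (r ^+ 2 * E r)) =
    Q r / 2 * ((r * f1 r + (nn - 2) / 2 * f r) ^+ 2 + (r * g1 r + (nn - 2) / 2 * g r) ^+ 2).
    by rewrite /N; field.
  by rewrite mulr_ge0 ?addr_ge0 ?sqr_ge0 // divr_ge0 // ltW.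
have h2 : m <= pohozaev 1 / k.
  rewrite ler_pdivlMr //.
  have : m * 2 <= m * m `^ (2 / (nn - 2)) by rewrite ler_pM2l // ltW.
  rewrite -(ler_pM2l k0) => /le_trans /(_ key); lra.
apply: le_trans h2 _; apply: le_trans (ler_norm _) _.
by rewrite lerDr ltW.
Qed.

Lemma is_derive_ratio r : 0 < r ->
  is_derive r 1 (fun t => g t * (f t)^-1)
    ((f r * g1 r - g r * f1 r) / (f r * f r)).
Proof.
move=> r0; have fn0 : f r != 0 by rewrite gt_eqF ?f0.
have dV : is_derive r 1 (fun t => (f t)^-1) (- (f r ^- 2) * f1 r).
  apply: (@is_derive_comp1 _ _ f r 1 (f1 r) (fun t : R => t^-1)); first exact: df.
  apply: is_derive_eq; first by apply: is_deriveV => //; exact: is_derive_id.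
  by rewrite scaleNr [_ *: _]mulr1.
apply: is_derive_eq; first exact: (is_deriveMf (dg r0) dV).
by rewrite /=; field.
Qed.

(** If w > 0, then (g/f)' = w / (r^(n-1) f^2) >= w / (M r), so g/f - (w/M) ln r is nondecreasing and
    g/f becomes negative near 0. *)
Lemma wronskian_le0 r : 0 < r -> wronskian r <= 0.
Proof.
move=> r0; rewrite leNgt; apply/negP => w0.
set w := wronskian r in w0.
have [M M0 hM] := scaled_mass_bounded.
have wE t : 0 < t -> wronskian t = w.
  by move=> t0; exact: (constant_pos wronskian_constant).
pose F t := g t * (f t)^-1 - w / M * ln t.
pose dF t := (f t * g1 t - g t * f1 t) / (f t * f t) - w / M * t^-1.
have hF (t : R) : 0 < t -> is_derive t 1 F (dF t).
  move=> t0; apply: is_deriveBf; first exact: is_derive_ratio.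
  by apply: is_deriveZf; exact: is_derive1_ln.
have dF0 t : 0 < t -> 0 <= dF t.
  move=> t0; have ft := f0 t0; have gt0' := g0 t0.
  have P1 : t `^ (nn - 1) = t * Q t.
    by rewrite (_ : nn - 1 = nn - 2 + 1); [exact: powRS|ring].
  have Q0 : 0 < Q t by rewrite powR_gt0.
  have tQ0 : 0 < t * Q t by rewrite mulr_gt0.
  rewrite /dF; have -> : f t * g1 t - g t * f1 t = w / (t * Q t).
    by rewrite -(wE t t0) /wronskian P1 mulrAC divff ?mul1r // gt_eqF.
  rewrite subr_ge0.
  have -> : w / (t * Q t) / (f t * f t) = w * t^-1 * (Q t * (f t * f t))^-1.
    by field; rewrite !gt_eqF.
  have -> : w / M * t^-1 = w * t^-1 * M^-1 by ring.
  have wt0 : 0 <= w * t^-1 by apply: mulr_ge0; rewrite ?invr_ge0 ltW.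
  apply: ler_wpM2l => //; rewrite lef_pV2 ?posrE ?mulr_gt0 //.
  apply: le_trans (hM t t0); rewrite ler_pM2l // lerDl.
  by rewrite mulr_ge0 // ltW.
pose A := g 1 * (f 1)^-1.
have A0 : 0 < A by rewrite mulr_gt0 ?invr_gt0 ?f0 ?g0.
(* At this t monotonicity gives g/f <= A - (A + 1) = -1. *)
pose t := expR (- (M / w * (A + 1))).
have t0 : 0 < t by exact: expR_gt0.
have B0 : 0 <= M / w * (A + 1).
  by rewrite mulr_ge0 ?divr_ge0 ?(ltW M0) ?(ltW w0) //; lra.
have t1 : t <= 1 by rewrite /t -[leRHS]expR0 ler_expR oppr_le0.
have := monotone_pos hF dF0 t0 t1; rewrite /F ln1 mulr0 subr0 -/A /t expRK.
have -> : w / M * (- (M / w * (A + 1))) = - (A + 1).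
  by field; rewrite !gt_eqF.
have : 0 < g t * (f t)^-1 by rewrite mulr_gt0 ?invr_gt0 ?f0 ?g0.
rewrite -/t; lra.
Qed.

End RadialSystem.

(** Exchanging f and g changes the sign of the Wronskian, so the one-sided bound applied twice makes
    it vanish. *)
Lemma radial_system_proportional (R : realType) (nn : R) (f g f1 g1 : R -> R) :
  3 <= nn -> (forall r, 0 < r -> 0 < f r) -> (forall r, 0 < r -> 0 < g r) ->
  (forall r : R, 0 < r -> is_derive r 1 f (f1 r)) ->
  (forall r : R, 0 < r -> is_derive r 1 g (g1 r)) ->
  (forall r : R, 0 < r -> is_derive r 1 f1 (- ((nn - 1) / r * f1 r) -
     nn * (nn - 2) / 4 * (f r * f r + g r * g r) `^ (2 / (nn - 2)) * f r)) ->
  (forall r : R, 0 < r -> is_derive r 1 g1 (- ((nn - 1) / r * g1 r) -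
     nn * (nn - 2) / 4 * (f r * f r + g r * g r) `^ (2 / (nn - 2)) * g r)) ->
  forall r, 0 < r -> g r = g 1 / f 1 * f r.
Proof.
move=> n3 f0 g0 df dg df1 dg1.
have w1 r : 0 < r -> wronskian nn f g f1 g1 r <= 0.
  exact: (@wronskian_le0 R nn f g f1 g1 n3 f0 g0 df dg df1 dg1 r).
have sw t : f t * f t + g t * g t = g t * g t + f t * f t by rewrite addrC.
have w2 r : 0 < r -> wronskian nn g f g1 f1 r <= 0.
  apply: (@wronskian_le0 R nn g f g1 f1 n3 g0 f0 dg df) => t t0.
    by rewrite -sw; exact: dg1.
  by rewrite -sw; exact: df1.
have w r : 0 < r -> f r * g1 r - g r * f1 r = 0.
  move=> r0; have P : 0 < r `^ (nn - 1) by rewrite powR_gt0.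
  have := w1 r r0; have := w2 r r0.
  by rewrite /wronskian !(pmulr_rle0 _ P); lra.
move=> r r0; have fr := f0 r r0; have f1' := f0 1 ltr01.
have : g r * (f r)^-1 = g 1 * (f 1)^-1.
  apply: (@constant_pos _ (fun t => g t * (f t)^-1)) => // t t0.
  by apply: is_derive_eq; [exact: (is_derive_ratio f0)|rewrite w // mul0r].
by move=> <-; rewrite divfK // gt_eqF.
Qed.

(** * Conclusion *)

Section Smoothness.
Context {R : realType} {n : nat}.
Implicit Types (f g : 'rV[R]_n -> R) (A : set 'rV[R]_n).

Lemma near_eq_continuous (T : topologicalType) (f g : T -> R) (p : T) :
  (\forall q \near p, f q = g q) -> {for p, continuous f} ->
  {for p, continuous g}.
Proof.
move=> e cf; rewrite /prop_for /continuous_at -(nbhs_singleton e).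
by apply: cvg_trans cf; apply: near_eq_cvg; apply: filterS e => q ->.
Qed.

Lemma C1_on_eq A f g : open A -> (forall z, A z -> f z = g z) ->
  C1_on A f -> C1_on A g.
Proof.
move=> oA fg c1 x Ax; have [cf df] := c1 x Ax.
have nA : \forall z \near x, A z by exact: (open_nbhs_nbhs (conj oA Ax)).
have e : \forall z \near x, f z = g z by apply: filterS nA => z /fg.
split; first exact: near_eq_continuous cf.
move=> i; have [d1 d2] := df i; split; first exact: near_eq_derivable d1.
apply: near_eq_continuous d2.
by apply: near_nbhs e _ => z ez; exact: near_eq_derive.
Qed.

Lemma C1_on_scale A f (k : R) : open A -> C1_on A f ->
  C1_on A (fun z => k * f z).
Proof.
move=> oA c1 x Ax; have [cf df] := c1 x Ax.
have nA : \forall z \near x, A z by exact: (open_nbhs_nbhs (conj oA Ax)).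
split.
  by apply: (@continuousM R _ (cst k)) => //; exact: cst_continuous.
move=> i; have [d1 d2] := df i; split.
  by have [] := is_deriveZf k (derivableP d1).
apply: (@near_eq_continuous _ (fun z => k * partial i f z)).
  apply: filterS nA => z Az; have [_ /(_ i) [dz _]] := c1 z Az.
  by have [_ <-] := is_deriveZf k (derivableP dz).
by apply: (@continuousM R _ (cst k)) => //; exact: cst_continuous.
Qed.

Lemma C2_on_scale A f (k : R) : open A -> C2_on A f ->
  C2_on A (fun z => k * f z).
Proof.
move=> oA [c1 c2]; split; first exact: C1_on_scale.
move=> i; apply: (C1_on_eq oA) (C1_on_scale k oA (c2 i)) => z Az.
have [_ /(_ i) [dz _]] := c1 z Az.
by have [_ <-] := is_deriveZf k (derivableP dz).
Qed.

End Smoothness.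

(** * Reduction of the equations to the radial system *)

Section Reduction.
Context {R : realType} {n : nat} (hn : (3 <= n)%N) {U : 'rV[R]_n -> 'rV[R]_2}
  (hU : nonneg_singular_solution U).
Implicit Types (x y z : 'rV[R]_n) (r s : R) (i : 'I_2).

Local Notation a := (4 / (n%:R - 2) : R).
Local Notation c := (n%:R * (n%:R - 2) / 4 : R).
Local Notation u := (component U).

Let i0 : 'I_n := Ordinal (leq_trans (isT : (0 < 3)%N) hn).

Definition ray r : 'rV[R]_n := r *: evec R i0.

Lemma sqn_ray r : sqn (ray r) = r ^+ 2.
Proof.
rewrite sqnE dotZl dotZr /dot (bigD1 i0) //= big1 ?addr0.
  by rewrite /evec !mxE !eqxx /= !mulr1 expr2.
by move=> j ji; rewrite !mxE (negbTE ji) mulr0.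
Qed.

Lemma ray_neq0 r : 0 < r -> ray r != 0.
Proof. by move=> r0; rewrite -sqn_gt0 sqn_ray exprn_gt0. Qed.

Definition profile i r := u i (ray r).
Definition dprofile i r := partial i0 (u i) (ray r).

Lemma C2_u i : C2_on (@punctured R n) (u i).
Proof. by have [C2 _ _ _] := hU. Qed.

Lemma is_derive_ray f r : 0 < r -> derivable f (ray r) (evec R i0) ->
  is_derive r 1 (fun t => f (ray t)) (partial i0 f (ray r)).
Proof.
move=> r0 df; have := @is_derive_slice_at R _ f 0 (evec R i0) r (partial i0 f (ray r)).
have -> : (fun t : R => f (t *: evec R i0 + 0)) = (fun t => f (ray t)).
  by apply/funext => t; rewrite addr0.
by apply; rewrite addr0; exact: derivableP.
Qed.

Lemma is_derive_profile i r : 0 < r ->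
  is_derive r 1 (profile i) (dprofile i r).
Proof.
move=> r0; apply: is_derive_ray => //.
by have [/(_ _ (ray_neq0 r0)) [_ /(_ i0) []]] := C2_u i.
Qed.

Lemma is_derive_dprofile i r : 0 < r ->
  is_derive r 1 (dprofile i) (partial i0 (partial i0 (u i)) (ray r)).
Proof.
move=> r0; apply: is_derive_ray => //.
by have [_ /(_ i0) /(_ _ (ray_neq0 r0)) [_ /(_ i0) []]] := C2_u i.
Qed.

(** The Euclidean norm, written as a power so that the derivative rule for powers of [sqn]
    applies. *)
Definition radius z : R := sqn z `^ (1 / 2).

Lemma radius_ray r : 0 < r -> radius (ray r) = r.
Proof.
move=> r0; rewrite /radius sqn_ray -powR_mulrn ?ltW // -powRrM.
by rewrite (_ : 2%:R * (1 / 2) = 1) ?powRr1 ?ltW //; field.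
Qed.

Lemma radius_gt0 z : z != 0 -> 0 < radius z.
Proof. by move=> z0; rewrite powR_gt0 // sqn_gt0. Qed.

Lemma u_profile i z : z != 0 -> u i z = profile i (radius z).
Proof.
move=> z0; apply: (u_radial hn hU) => //.
rewrite sqn_ray /radius -powR_mulrn ?powR_ge0 // -powRrM.
by rewrite (_ : 1 / 2 * 2%:R = 1) ?powRr1 ?sqn_ge0 //; field.
Qed.

Lemma is_derive_sqn_powR0 z (p : R) (j : 'I_n) : z != 0 ->
  is_derive z (evec R j) (fun w => sqn w `^ p)
    (p * sqn z `^ (p - 1) * (2 * z ord0 j)).
Proof.
move=> z0; have q0 : 0 < sqn (z - 0) by rewrite subr0 sqn_gt0.
have := is_derive_sqn_powR p j q0; rewrite subr0.
by congr (is_derive _ _ _ _); apply/funext => w; rewrite subr0.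
Qed.

(** By radial symmetry the first derivative is u'(|z|) z_j / |z|. On the ray z_j = 0, so only the
    term that differentiates z_j survives. *)
Lemma tangential_second_derivative i r (j : 'I_n) : 0 < r -> j != i0 ->
  partial j (partial j (u i)) (ray r) = dprofile i r / r.
Proof.
move=> r0 ji; have ry := ray_neq0 r0.
pose G z := dprofile i (radius z) *
  (1 / 2 * sqn z `^ (1 / 2 - 1) * (2 * z ord0 j)).
have dG z : z != 0 -> is_derive z (evec R j) (u i) (G z).
  move=> z0; apply: (@near_eq_is_derive _ _ _ (fun w => profile i (radius w))).
    have oz : open_nbhs z (@punctured R n) by split; [exact: open_punctured|].
    by apply: filterS (open_nbhs_nbhs oz) => w w0; rewrite u_profile.
  apply: is_derive_comp1; first exact: is_derive_sqn_powR0.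
  by apply: is_derive_profile; exact: radius_gt0.
have -> : partial j (partial j (u i)) (ray r) = 'D_(evec R j) G (ray r).
  apply: near_eq_derive.
  have oz : open_nbhs (ray r) (@punctured R n) by split; [exact: open_punctured|].
  by apply: filterS (open_nbhs_nbhs oz) => w w0; have [_ <-] := dG w w0.
have rj : ray r ord0 j = 0 by rewrite !mxE (negbTE ji) mulr0.
have h1 : is_derive (ray r) (evec R j) (fun z => z ord0 j : R) 1.
  have := is_derive_coord 0 (ray r) j j; rewrite eqxx.
  by congr (is_derive _ _ _ _); apply/funext => w; rewrite subr0.
have h2 := is_deriveMf (is_deriveZf (1 / 2) (is_derive_sqn_powR0 (1 / 2 - 1) j ry))
  (is_deriveZf 2 h1).
have h3 := is_derive_comp1 (is_derive_sqn_powR0 (1 / 2) j ry)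
  (is_derive_dprofile i (radius_gt0 ry)).
have [_ ->] := is_deriveMf h3 h2.
rewrite /= rj -/(radius _) radius_ray // sqn_ray.
have -> : (r ^+ 2) `^ (1 / 2 - 1) = r^-1.
  rewrite -[RHS]powR_inv1 ?(ltW r0) // -powR_mulrn ?(ltW r0) // -powRrM.
  by congr (_ `^ _); field.
by field; rewrite gt_eqF.
Qed.

Lemma enorm_U_pow y : enorm (U y) `^ a =
  (u ord0 y * u ord0 y + u (lift ord0 ord0) y * u (lift ord0 ord0) y) `^ (2 / (n%:R - 2)).
Proof.
have n3 := dim_ge3 hn (R := R).
rewrite /enorm -powR12_sqrt ?sqn_ge0 // -powRrM.
have -> : 2^-1 * a = 2 / (n%:R - 2) by field; rewrite gt_eqF //; lra.
by rewrite !big_ord_recl big_ord0 addr0 !expr2.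
Qed.

Lemma profile_ode i r : 0 < r -> is_derive r 1 (dprofile i)
  (- ((n%:R - 1) / r * dprofile i r) -
   c * (profile ord0 r * profile ord0 r + profile (lift ord0 ord0) r *
        profile (lift ord0 ord0) r) `^ (2 / (n%:R - 2)) * profile i r).
Proof.
move=> r0; apply: is_derive_eq; first exact: is_derive_dprofile.
have := lap_u hU i (ray_neq0 r0); rewrite enorm_U_pow /laplacian (bigD1 i0) //=.
rewrite (eq_bigr (fun=> dprofile i r / r)); last first.
  by move=> j ji; exact: tangential_second_derivative.
rewrite sumr_const cardC1 card_ord -[_ *+ n.-1]mulr_natl -subn1 natrB ?(leq_trans _ hn) //.
rewrite -/(profile i r) -/(profile ord0 r) -/(profile (lift ord0 ord0) r).
set P := partial _ _ _; set X := _ `^ (2 / _) => h.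
have {h} -> : P = - (c * X * profile i r) - (n%:R - 1) * (dprofile i r / r).
  by rewrite -h; ring.
by ring.
Qed.

Lemma u_proportional : (forall y, y != 0 -> 0 < u ord0 y) ->
  exists2 k, 0 <= k & forall y, y != 0 -> u (lift ord0 ord0) y = k * u ord0 y.
Proof.
move=> up; have [vz|vp] := u_zero_or_pos hn hU (lift ord0 ord0).
  by exists 0 => // y y0; rewrite vz // mul0r.
exists (profile (lift ord0 ord0) 1 / profile ord0 1).
  by rewrite divr_ge0 // ltW // ?up ?vp // ray_neq0.
move=> y y0; rewrite !u_profile //.
apply: (@radial_system_proportional R n%:R (profile ord0) (profile (lift ord0 ord0))
  (dprofile ord0) (dprofile (lift ord0 ord0))).
- exact: dim_ge3.
- by move=> r r0; exact/up/ray_neq0.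
- by move=> r r0; exact/vp/ray_neq0.
- exact: is_derive_profile.
- exact: is_derive_profile.
- exact: profile_ode.
- exact: profile_ode.
- exact: radius_gt0.
Qed.

(** Since L is a unit vector, k u_i equals |U|; this closes the scalar equation, with a + 1 =
    (n+2)/(n-2), and transfers the blow-up. *)
Lemma fowler_of_multiple i (k : R) (L : 'rV[R]_2) : 0 < k ->
  sphere1_plus L -> (forall y, y != 0 -> 0 < u i y) ->
  (forall y, y != 0 -> U y = (k * u i y) *: L) ->
  fowler_solution (fun y => k * u i y).
Proof.
move=> k0 [L1 L0] up UE.
have UN y : y != 0 -> enorm (U y) = k * u i y.
  move=> y0; have ku : 0 <= k * u i y by rewrite mulr_ge0 ?ltW // up.
  by rewrite (UE y y0) enormZ // L1 mulr1.
split.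
- by apply: C2_on_scale; [exact: open_punctured|exact: C2_u].
- by move=> y y0; rewrite mulr_gt0 // up.
- exists (fun r => k * profile i r) => y y0; congr (k * _).
  apply: (u_radial hn hU) => //; rewrite sqn_ray.
  by rewrite enorm_sqr.
- move=> y y0; have v0 : 0 < k * u i y by rewrite mulr_gt0 // up.
  rewrite (has_lap_laplacian (has_lapZ k (has_lap_u hU i y0))) UN //.
  have n3 := dim_ge3 hn (R := R).
  have -> : (n%:R + 2) / (n%:R - 2) = a + 1 :> R.
    by field; rewrite gt_eqF //; lra.
  by rewrite (powRS _ v0); ring.
- have [_ _ _ bl] := hU; apply/cvgryPgt => A.
  have nb : nbhs (0 : 'rV[R]_n) (fun z => z != 0 -> A < enorm (U z)).
    exact: (cvgry_gt bl A).
  have nk : nbhs (0 : 'rV[R]_n) (fun z => z != 0 -> A < k * u i z).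
    by apply: filterS nb => z h z0; rewrite -UN //; exact: h.
  exact: nk.
Qed.

End Reduction.

Theorem theorem1p2 (R : realType) (n : nat) (hn : (3 <= n)%N)
    (U : 'rV[R]_n -> 'rV[R]_2) (hU : nonneg_singular_solution U) :
  exists (Lambda : 'rV[R]_2) (u0 : 'rV[R]_n -> R),
    [/\ sphere1_plus Lambda, fowler_solution u0
      & forall x : 'rV[R]_n, punctured x -> U x = u0 x *: Lambda].
Proof.
pose j1 : 'I_2 := lift ord0 ord0.
suff [i [k [L [k0 SL up UE]]]] : exists (i : 'I_2) (k : R) (L : 'rV[R]_2),
  [/\ 0 < k, sphere1_plus L, forall y, y != 0 -> 0 < component U i y &
    forall y, y != 0 -> U y = (k * component U i y) *: L].
  by exists L, (fun y => k * component U i y); split => //; exact: fowler_of_multiple UE.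
have ordE (j : 'I_2) : j = ord0 \/ j = j1.
  by case: (unliftP ord0 j) => [t ->|->]; [right; rewrite (ord1 t)|left].
have [uz|up] := u_zero_or_pos hn hU ord0; last first.
  have [k k0 hk] := u_proportional hn hU up.
  (* U = u_1 (1, k), and m is the length of (1, k). *)
  pose m := Num.sqrt (1 + k ^+ 2).
  have m0 : 0 < m by rewrite sqrtr_gt0 ltr_wpDr // sqr_ge0.
  exists ord0, m, (\row_j (if j == ord0 then m^-1 else k / m)); split => //.
  - split; last by move=> j; rewrite mxE; case: ifP => _; rewrite ?invr_ge0 ?divr_ge0 // ltW.
    rewrite /enorm !big_ord_recl big_ord0 addr0 !mxE /=.
    rewrite (_ : _ + _ = 1) ?sqrtr1 //.
    have mm : m ^+ 2 = 1 + k ^+ 2 by rewrite sqr_sqrtr // addr_ge0 ?sqr_ge0.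
    have -> : m^-1 ^+ 2 + (k / m) ^+ 2 = (1 + k ^+ 2) / m ^+ 2.
      by field; rewrite gt_eqF.
    by rewrite mm divff // -mm expf_neq0 // gt_eqF.
  - move=> y y0; apply/rowP => j; rewrite !mxE.
    have mn : m != 0 by rewrite gt_eqF.
    case: (ordE j) => ->.
      by rewrite eqxx -[LHS]/(component U ord0 y); field.
    by rewrite -[LHS]/(component U j1 y) hk //=; field.
have [vz|vp] := u_zero_or_pos hn hU j1.
  (* Both components vanish here, which contradicts the blow-up at a point of the ray close to the
     origin. *)
  have [_ _ _ bl] := hU.
  have nb : nbhs (0 : 'rV[R]_n) (fun z => z != 0 -> 0 < enorm (U z)).
    exact: (cvgry_gt bl 0).
  have [r r0 hr] := nbhs_sqn_ball nb.
  (* The number r bounds the squared norm, so t must satisfy t^2 <= r. *)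
  pose t := Num.min r 1; have t0 : 0 < t by rewrite lt_min r0 ltr01.
  have t1 : t <= 1 by rewrite ge_min lexx orbT.
  have tr : t <= r by rewrite ge_min lexx.
  have ry := ray_neq0 hn t0.
  have := hr (ray hn t); rewrite subr0 sqn_ray => /(_ _ ry).
  have -> : U (ray hn t) = 0.
    apply/rowP => j; rewrite mxE.
    by case: (ordE j) => ->; [exact: uz|exact: vz].
  rewrite /enorm big1 ?sqrtr0 ?ltxx => [|j _]; last by rewrite mxE expr0n.
  move=> h; exfalso; suff : t ^+ 2 <= r by move=> /h.
  by apply: le_trans tr; rewrite expr2 ler_piMl // ltW.
exists j1, 1, (\row_j (if j == ord0 then 0 else 1)); split => //.
- split; last by move=> j; rewrite mxE; case: ifP => _; rewrite ?ler01 ?lexx.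
  rewrite /enorm !big_ord_recl big_ord0 addr0 !mxE /=.
  by rewrite expr0n expr1n add0r sqrtr1.
- move=> y y0; apply/rowP => j; rewrite !mxE mul1r.
  case: (ordE j) => ->.
    by rewrite eqxx mulr0; exact: uz.
  by rewrite mulr1.
Qed.
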